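(* Let $T_0:[0,1]\to[0,1]$ be Borel measurable, $\rho$ a Lipschitz probability density on $\mathbb R$ supported on $[-1,1]$, and $L_0f(x)=\int k_0(x,y)f(y)\,dy$ on $L^2$ with $k_0(x,y)=(P_\pi\tau_{-T_0(y)}\rho)(x)$; suppose $L_0$ satisfies (A1): $\lim_{n\to\infty}\|L_0^ng\|_2=0$ for every $g\in V$. Let $c\in\mathrm{span}\{f_0\}^\perp$, $\ell\geq 0$ and $P_\ell:=S_{T_0,\ell}\cap B_1$. Assume that the function $\mathcal J(\dot T):=\langle c,\widehat R(\dot T)\rangle_{L^2([0,1],\mathbb R)}$ is not uniformly vanishing on $P_\ell$. Then the problem of finding $\dot T\in P_\ell$ such that $$\langle c,\widehat R(\dot T)\rangle_{L^2([0,1],\mathbb R)}=\max_{\dot h\in P_\ell}\langle c,\widehat R(\dot h)\rangle_{L^2([0,1],\mathbb R)}$$ has a unique solution $\dot T\in L^2$.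
   Context: $L^2=L^2([0,1],\mathbb R)$ with Lebesgue measure $m$; $V:=\{f\in L^2:\int f\,dm=0\}$. $(\tau_bg)(x):=g(x+b)$; $P_\pi f(x):=\sum_{i\in2\mathbb Z}(f(i+x)+f(i-x))$ for $x\in[0,1]$. $d\rho/dx$ is the a.e. derivative. $f_0$ is the unique function in $L^2$ with $L_0f_0=f_0$ and $\int f_0\,dm=1$. $\widehat R:L^2\to L^2$ is $$\widehat R(\dot T):=-(\mathrm{Id}-L_0)^{-1}\int_0^1\left(P_\pi\left(\tau_{-T_0(y)}\tfrac{d\rho}{dx}\right)\right)(\cdot)\,\dot T(y)f_0(y)\,dy,$$ where $(\mathrm{Id}-L_0)^{-1}:V\to V$ is the bounded inverse of $\mathrm{Id}-L_0$ on $V$ (the integral lies in $V$). $\widetilde F_\ell:=\{x\in[0,1]:\ell\le T_0(x)\le1-\ell\}$; $S_{T_0,\ell}:=\{T\in L^2:\mathrm{supp}(T)\subseteq\widetilde F_\ell\}$ (i.e. $T=0$ a.e. outside $\widetilde F_\ell$); $B_1$ is the closed unit ball of $L^2$. *)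

(* Defs.v *)
From HB Require Import structures.
From mathcomp Require Export all_boot all_order all_algebra.
From mathcomp Require Export all_classical all_reals all_analysis.
Set Implicit Arguments.
Unset Strict Implicit.
Unset Printing Implicit Defensive.
Import Order.TTheory GRing.Theory Num.Theory.
Export numFieldNormedType.Exports.

Local Open Scope classical_set_scope.
Local Open Scope ring_scope.

(* A class in L^2([0,1]) is handled through its
   representatives: measurable functions R -> R with finite 2-norm for mu01,
   compared up to equality mu01-almost everywhere.  The operators L0, Rhat and
   the resolvent depend only on the a.e. class of their argument on [0,1], the
   resolvent being itself determined up to a.e. equality. *)

Definition mu01 (R : realType) : {measure set (measurableTypeR R) -> \bar R} :=
  mrestr (@lebesgue_measure R) (measurable_itv `[0%R, 1%R]).

Definition L2 (R : realType) : set (R -> R) :=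
  [set f : R -> R | f \in Lfun (@mu01 R) 2%:E].

Definition norm2 (R : realType) (f : R -> R) : \bar R :=
  ('N[@mu01 R]_2%:E [EFin \o f])%E.

Definition inner (R : realType) (f g : R -> R) : R :=
  \int[@mu01 R]_x (f x * g x).

Definition span1 (R : realType) (f : R -> R) : set (R -> R) :=
  [set fun x : R => a * f x | a in [set: R]].

Definition orthogonal_compl (R : realType) (A : set (R -> R)) : set (R -> R) :=
  [set c | L2 c /\ forall g, A g -> inner c g = 0].

Definition V (R : realType) : set (R -> R) :=
  [set g | L2 g /\ \int[@mu01 R]_x g x = 0].

Definition probability_density (R : realType) (rho : R -> R) : Prop :=
  [/\ measurable_fun setT rho, forall x, 0 <= rho x &
      (\int[@lebesgue_measure R]_x (rho x)%:E = 1)%E].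

Definition tau (R : realType) (b : R) (g : R -> R) : R -> R :=
  fun x => g (x + b).

(* [\sum_(i \in _)] is the sum over the indices with a nonzero term, and is 0
   when there are infinitely many of them; it is a genuine finite sum at every
   x when f vanishes outside a bounded set, the only case used. *)
Definition P_pi (R : realType) (f : R -> R) : R -> R := fun x =>
  \sum_(i \in [set i : int | (2 %| i)%Z]) (f (i%:~R + x) + f (i%:~R - x)).

Definition k0 (R : realType) (rho T0 : R -> R) (x y : R) : R :=
  P_pi (tau (- T0 y) rho) x.

Definition L0 (R : realType) (rho T0 : R -> R) (f : R -> R) : R -> R :=
  fun x => \int[@lebesgue_measure R]_(y in `[0, 1]) (k0 rho T0 x y * f y).

Definition A1 (R : realType) (L : (R -> R) -> R -> R) : Prop :=
  forall g, V g -> norm2 (iter n L g) @[n --> \oo] --> 0%E.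

(* Under A1 for a Markov operator L there is at most one such f, a.e. *)
Definition normalized_fixed_point (R : realType) (L : (R -> R) -> R -> R)
    (f : R -> R) : Prop :=
  [/\ L2 f, L f = f %[ae @mu01 R] & \int[@mu01 R]_x f x = 1].

(* The inverse of Id - L on V: a representative of the h in V with
   h - L h = g, and 0 if there is none. *)
Definition resolvent (R : realType) (L : (R -> R) -> R -> R) (g : R -> R) :
    R -> R :=
  xget (fun=> 0) [set h | V h /\ (fun x => h x - L h x) = g %[ae @mu01 R]].

(* [rho^`()] is the limit of the difference quotients, with an unspecified
   value at the points, Lebesgue-negligible for Lipschitz rho, where there is
   none. *)
Definition Rhat (R : realType) (rho T0 f0 : R -> R) (T : R -> R) : R -> R :=
  fun x => - resolvent (L0 rho T0)
    (fun z => \int[@lebesgue_measure R]_(y in `[0, 1])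
                (P_pi (tau (- T0 y) rho^`()%classic) z * T y * f0 y)) x.

Definition Ftilde (R : realType) (T0 : R -> R) (l : R) : set R :=
  [set x | x \in `[0, 1] /\ l <= T0 x <= 1 - l].

Definition S_supp (R : realType) (T0 : R -> R) (l : R) : set (R -> R) :=
  [set T | L2 T /\ {ae @mu01 R, forall x, ~ Ftilde T0 l x -> T x = 0}].

Definition B1 (R : realType) : set (R -> R) :=
  [set T | L2 T /\ (norm2 T <= 1)%E].

Definition maximizes (R : realType) (P : set (R -> R)) (J : (R -> R) -> R)
    (T : R -> R) : Prop :=
  P T /\ forall h, P h -> J h <= J T.

(* Main.v *)
(* On functions of zero mean, [L0] is contracted after finitely many steps:
   writing [k] for its kernel, [k x z - k x z0] is a zero-mean function of [x],
   so its iterates tend to 0 in [L1] for each [z] by A1, hence on average over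
   [z] by dominated convergence, and [L0 g] is an average of these columns
   whenever [g] has zero mean.  The Neumann series therefore gives a bounded
   kernel [H] with [H - L0 H = P_pi (tau (- T0 y) rho')] columnwise, and Fubini
   turns [J] into [T |-> \int w T] for an explicit [w] in [L2].  A linear form
   on [L2] has a unique maximizer [w 1_F / ||w 1_F||] on the unit ball of the
   functions supported in [F], unless it vanishes there.  That the columns
   [P_pi (tau (- T0 y) rho')] have zero mean rests on the almost everywhere
   differentiability of the Lipschitz function [rho], which follows from the
   Radon-Nikodym theorem for the Stieltjes measure of [rho + K x]. *)

From HB Require Import structures.
Require Import Defs.
From mathcomp Require Import measurable_realfun ring lra zify.
Set Implicit Arguments.
Unset Strict Implicit.
Unset Printing Implicit Defensive.
Import Order.TTheory GRing.Theory Num.Theory.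
Local Open Scope classical_set_scope.
Local Open Scope ring_scope.

(** * Integral operators on a probability space *)

Section kernel_operators.
Context d (X : measurableType d) (R : realType) (mu : probability X R).
Implicit Types (K A B : X -> X -> R) (f g u v : X -> R) (M : R).

Notation L1 f := (mu.-integrable setT (EFin \o f)).

Lemma integrable_le_cst M f :
  measurable_fun setT f -> (forall x, `|f x| <= M) -> L1 f.
Proof.
move=> mf fM; apply: measurable_bounded_integrable => //.
  by rewrite [ltLHS]probability_setT ltry.
by exists M; split; [exact: num_real|move=> y My x _; exact: le_trans (fM x) (ltW My)].
Qed.

Lemma integrable_normr f : L1 f -> L1 (fun x => `|f x|).
Proof. by move=> /integrable_abse. Qed.

Lemma integrable_mul_le_cst M f g : measurable_fun setT f ->
  (forall x, `|f x| <= M) -> L1 g -> L1 (fun x => f x * g x).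
Proof.
move=> mf fM ig; have mg := measurable_int _ ig.
apply: (@le_integrable _ _ _ mu setT measurableT _ (fun x => `|M|%:E * `|(g x)%:E|)%E).
- apply/measurable_EFinP; apply: measurable_funM => //; exact/measurable_EFinP.
- move=> x _ /=; rewrite lee_fin !normrM !normr_id ler_wpM2r//.
  exact: le_trans (fM x) (ler_norm _).
- by apply: integrableZl => //; exact: integrable_abse.
Qed.

Lemma Rintegral_cstT (r : R) : \int[mu]_x r = r.
Proof. by rewrite Rintegral_cst// [X in fine X]probability_setT mulr1. Qed.

Lemma le_RintegralT f g : L1 f -> L1 g -> (forall x, f x <= g x) ->
  \int[mu]_x f x <= \int[mu]_x g x.
Proof. by move=> fi gi fg; apply: le_Rintegral => // x _; exact: fg. Qed.

(** Tonelli makes the integrals of the positive and negative parts measurable in the parameter, and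
    [fine] is measurable; parameters at which [F] is not integrable are thereby covered as well. *)
Lemma measurable_Rintegral d' (Y : measurableType d') (F : Y * X -> R) :
  measurable_fun setT F -> measurable_fun setT (fun y => \int[mu]_x F (y, x)).
Proof.
move=> mF; rewrite /Rintegral.
apply: measurableT_comp; first exact: fine_measurable.
have mE : measurable_fun setT (EFin \o F) by exact/measurable_EFinP.
under eq_fun do rewrite integralE.
apply: emeasurable_funB.
- rewrite (_ : (fun x => _) = fubini_F mu (EFin \o F)^\+%E).
    by apply: measurable_fun_fubini_tonelli_F => //; exact: measurable_funepos.
  by apply/funext => y; apply: eq_integral => x _; rewrite !funeposE.
- rewrite (_ : (fun x => _) = fubini_F mu (EFin \o F)^\-%E).
    by apply: measurable_fun_fubini_tonelli_F => //; exact: measurable_funeneg.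
  by apply/funext => y; apply: eq_integral => x _; rewrite !funenegE.
Qed.

(** The bound holds everywhere rather than almost everywhere, so that each single row and column is
    a bounded measurable function. *)
Definition bounded_kernel M K :=
  measurable_fun setT (fun p : X * X => K p.1 p.2) /\ forall x y, `|K x y| <= M.

Lemma bounded_kernelT M K :
  bounded_kernel M K -> bounded_kernel M (fun x y => K y x).
Proof.
move=> [mK KM]; split=> // ; apply: (measurableT_comp mK (g := fun p : X * X => (p.2, p.1))).
exact: measurable_fun_pair.
Qed.

Lemma bounded_kernel_row M K x : bounded_kernel M K -> measurable_fun setT (K x).
Proof. by move=> [mK _]; exact: measurableT_comp mK (pair1_measurable x). Qed.

Lemma bounded_kernel_col M K y : bounded_kernel M K -> measurable_fun setT (K ^~ y).
Proof. by move=> [mK _]; exact: measurableT_comp mK (pair2_measurable y). Qed.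

Lemma bounded_kernel_ge0 M K : bounded_kernel M K -> 0 <= M.
Proof. by move=> [_ KM]; exact: le_trans (normr_ge0 _) (KM point point). Qed.

Definition kernel_op K g x := \int[mu]_y (K x y * g y).

Lemma kernel_op_integrand M K v x :
  bounded_kernel M K -> L1 v -> L1 (fun y => K x y * v y).
Proof.
move=> bK iv; apply: (integrable_mul_le_cst (M := M)) => //.
  exact: bounded_kernel_row bK.
exact: bK.2.
Qed.

Lemma kernel_op_le M K v x : bounded_kernel M K -> L1 v ->
  `|kernel_op K v x| <= M * \int[mu]_y `|v y|.
Proof.
move=> bK iv; have ib := kernel_op_integrand x bK iv.
apply: le_trans (le_normr_Rintegral measurableT ib) _.
rewrite -RintegralZl//; last exact: integrable_normr.
apply: le_RintegralT.
- exact: (integrable_normr ib).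
- apply: (integrableZl measurableT M (f := fun y => `|v y|%:E)).
  exact: integrable_normr.
- by move=> y; rewrite normrM ler_wpM2r// bK.2.
Qed.

Lemma measurable_kernel_op M K v : bounded_kernel M K -> L1 v ->
  measurable_fun setT (kernel_op K v).
Proof.
move=> bK iv; apply: (measurable_Rintegral (F := fun p : X * X => K p.1 p.2 * v p.2)).
apply: measurable_funM; first exact: bK.1.
apply: measurableT_comp => //.
by have /measurable_EFinP := measurable_int _ iv.
Qed.

Lemma kernel_op_integrable M K v : bounded_kernel M K -> L1 v ->
  L1 (kernel_op K v).
Proof.
move=> bK iv; apply: integrable_le_cst (measurable_kernel_op bK iv) _.
by move=> x; exact: (kernel_op_le x bK iv).
Qed.

(** Fubini for [u x * (K x y * v y)], integrable on the product because [K] is bounded. Conservation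
    of mass, associativity of composition and the transposition of the objective all come from
    it. *)
Lemma kernel_op_adjoint M K u v : bounded_kernel M K -> L1 u -> L1 v ->
  \int[mu]_x (u x * kernel_op K v x) =
  \int[mu]_y (v y * kernel_op (fun y x => K x y) u y).
Proof.
move=> bK iu iv.
have mu' : measurable_fun setT u by have /measurable_EFinP := measurable_int _ iu.
have mv' : measurable_fun setT v by have /measurable_EFinP := measurable_int _ iv.
pose F (p : X * X) := u p.1 * (K p.1 p.2 * v p.2).
have mF : measurable_fun setT F.
  apply: measurable_funM; first exact: measurableT_comp.
  apply: measurable_funM; first exact: bK.1.
  exact: measurableT_comp.
have uKv x : u x * kernel_op K v x = \int[mu]_y F (x, y).
  by rewrite -RintegralZl//; exact: kernel_op_integrand bK iv.
have vKu y : v y * kernel_op (fun y x => K x y) u y = \int[mu]_x F (x, y).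
  rewrite -RintegralZl//; last exact: kernel_op_integrand (bounded_kernelT bK) iu.
  by apply: eq_Rintegral => x _; rewrite /F/=; ring.
have absF x : (\int[mu]_y `|(F (x, y))%:E| =
     (`|u x| * \int[mu]_y (`|K x y| * `|v y|))%:E)%E.
  rewrite -RintegralZl//; last first.
    have := integrable_normr (kernel_op_integrand x bK iv).
    by under eq_fun do rewrite /= normrM.
  have iF : L1 (fun y => F (x, y)).
    apply: (integrableZl measurableT (u x) (f := fun y => (K x y * v y)%:E)).
    exact: kernel_op_integrand bK iv.
  rewrite /Rintegral fineK.
    by apply: eq_integral => y _; rewrite /= -!normrM.
  apply: integrable_fin_num => //.
  have := integrable_normr iF.
  by under eq_fun do rewrite /= !normrM.
have iF : (mu \x mu)%E.-integrable setT (EFin \o F).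
  apply/integrable12ltyP; first exact/measurable_EFinP.
  under eq_integral do rewrite absF.
  (* After the inner integration, the integrand is [|u|] times the bounded function obtained by
     applying [|K|] to [|v|]. *)
  have bK' : bounded_kernel M (fun x y => `|K x y|).
    by split=> [|x y]; [exact: measurableT_comp bK.1|rewrite normr_id bK.2].
  have iv' := integrable_normr iv.
  have := integrable_mul_le_cst (measurable_kernel_op bK' iv')
    (fun x => kernel_op_le x bK' iv') (integrable_normr iu).
  move=> /(integrable_fin_num measurableT).
  rewrite ge0_fin_numE.
    apply: le_lt_trans; rewrite le_eqVlt; apply/orP; left; apply/eqP.
    by apply: eq_integral => x _; rewrite /= mulrC.
  apply: integral_ge0 => x _; rewrite lee_fin mulr_ge0//.
  by apply: Rintegral_ge0 => y _; rewrite mulr_ge0.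
transitivity (\int[mu]_x \int[mu]_y F (x, y)).
  by apply: eq_Rintegral => x _; exact: uKv.
transitivity (\int[mu]_y \int[mu]_x F (x, y)); last first.
  by apply: eq_Rintegral => y _; rewrite vKu.
rewrite /Rintegral; congr fine.
have {}uKv x : ((fine (\int[mu]_y (F (x, y))%:E))%:E = \int[mu]_y (F (x, y))%:E)%E.
  rewrite fineK//; apply: integrable_fin_num => //.
  apply: (integrableZl measurableT (u x) (f := fun y => (K x y * v y)%:E)).
  exact: kernel_op_integrand bK iv.
have {}vKu y : ((fine (\int[mu]_x (F (x, y))%:E))%:E = \int[mu]_x (F (x, y))%:E)%E.
  rewrite fineK//; apply: integrable_fin_num => //.
  under eq_fun do rewrite /F /= mulrCA.
  under eq_fun do rewrite mulrA mulrC.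
  apply: (integrableZl measurableT (v y) (f := fun x => (K x y * u x)%:E)).
  exact: (kernel_op_integrand y (bounded_kernelT bK) iu).
under eq_integral do rewrite uKv.
under [RHS]eq_integral do rewrite vKu.
exact: (Fubini iF).
Qed.

Definition kernel_comp A B x y := kernel_op A (B ^~ y) x.

Lemma bounded_kernel_col_int M K y : bounded_kernel M K -> L1 (K ^~ y).
Proof.
by move=> bK; apply: integrable_le_cst (bounded_kernel_col y bK) _ => x; exact: bK.2.
Qed.

Lemma bounded_kernel_row_int M K x : bounded_kernel M K -> L1 (K x).
Proof.
by move=> bK; apply: integrable_le_cst (bounded_kernel_row x bK) _ => y; exact: bK.2.
Qed.

Lemma Rintegral_norm_le M f : measurable_fun setT f -> (forall x, `|f x| <= M) ->
  \int[mu]_x `|f x| <= M.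
Proof.
move=> mf fM; rewrite -[leRHS]Rintegral_cstT; apply: le_RintegralT => //.
- exact: integrable_normr (integrable_le_cst mf fM).
- exact: finite_measure_integrable_cst.
Qed.

Lemma bounded_kernel_comp M N A B : bounded_kernel M A -> bounded_kernel N B ->
  bounded_kernel (M * N) (kernel_comp A B).
Proof.
move=> bA bB; split=> [|x y]; last first.
  apply: le_trans (kernel_op_le x bA (bounded_kernel_col_int y bB)) _.
  rewrite ler_wpM2l ?(bounded_kernel_ge0 bA)//.
  apply: Rintegral_norm_le (bounded_kernel_col y bB) _ => z; exact: bB.2.
apply: (measurable_Rintegral
  (F := fun p : (X * X) * X => A p.1.1 p.2 * B p.2 p.1.2)).
apply: measurable_funM.
- apply: (measurableT_comp bA.1 (g := fun p : (X * X) * X => (p.1.1, p.2))).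
  apply: measurable_fun_pair => //; exact: measurableT_comp.
- apply: (measurableT_comp bB.1 (g := fun p : (X * X) * X => (p.2, p.1.2))).
  apply: measurable_fun_pair => //; exact: measurableT_comp.
Qed.

(** For fixed [x] this is the adjoint identity with the row [A x] in the role of [u]. *)
Lemma kernel_opA M N A B v x : bounded_kernel M A -> bounded_kernel N B -> L1 v ->
  kernel_op A (kernel_op B v) x = kernel_op (kernel_comp A B) v x.
Proof.
move=> bA bB iv.
rewrite /kernel_op (kernel_op_adjoint bB (bounded_kernel_row_int x bA) iv).
apply: eq_Rintegral => y _; rewrite mulrC; congr (_ * _).
by apply: eq_Rintegral => z _; rewrite mulrC.
Qed.

End kernel_operators.

(** * Sequences with geometrically small increments *)

Section geometric.
Variable R : realType.

Lemma cvg_half (C : R) : C * 2^-1 ^+ n @[n --> \oo] --> 0.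
Proof.
rewrite -[X in _ --> X](mulr0 C); apply: cvgMr; apply: cvg_expr.
by rewrite ger0_norm ?invr_ge0// invf_lt1 ?ltr1n.
Qed.

(** Reduces an identity for the limit of a series to an error bound for each partial sum. *)
Lemma le_half_eq0 (C z : R) : (forall n, `|z| <= C * 2^-1 ^+ n) -> z = 0.
Proof.
move=> zC; apply/eqP; rewrite -normr_le0.
rewrite -(cvg_lim (@Rhausdorff _) (cvg_half C)).
by apply: limr_ge; [exact: cvgP (cvg_half C)|exact: nearW].
Qed.

(** Adding the geometric tail makes [S] nonincreasing, subtracting it makes [S] nondecreasing. The
    two monotone sequences enclose [S] and share their limit, which yields convergence and rate
    together. *)
Lemma geometric_cvg (S : nat -> R) (C : R) :
  (forall n, `|S n.+1 - S n| <= C * 2^-1 ^+ n) ->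
  S n @[n --> \oo] --> limn S /\
  forall n, `|limn S - S n| <= 2 * C * 2^-1 ^+ n.
Proof.
move=> SC.
have C0 : 0 <= C by have := SC 0; rewrite expr0 mulr1; exact: le_trans.
have e0 n : (0 : R) <= 2^-1 ^+ n by rewrite exprn_ge0// invr_ge0.
pose a n := S n + 2 * C * 2^-1 ^+ n.
pose b n := S n - 2 * C * 2^-1 ^+ n.
have aS n : a n.+1 <= a n.
  have := SC n; rewrite ler_norml => /andP[_]; rewrite /a exprS.
  by rewrite (_ : 2 * C * (2^-1 * 2^-1 ^+ n) = C * 2^-1 ^+ n); [lra|field].
have bS n : b n <= b n.+1.
  have := SC n; rewrite ler_norml => /andP[+ _]; rewrite /b exprS.
  by rewrite (_ : 2 * C * (2^-1 * 2^-1 ^+ n) = C * 2^-1 ^+ n); [lra|field].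
have ab n : b n <= a n.
  have := mulr_ge0 C0 (e0 n); rewrite /a /b -(mulrA 2); lra.
have da : nonincreasing_seq a by apply/nonincreasing_seqP.
have db : nondecreasing_seq b by apply/nondecreasing_seqP.
have cva : cvgn a.
  apply: nonincreasing_is_cvgn => //; exists (b 0) => _ [n _ <-].
  exact: le_trans (db _ _ (leq0n n)) (ab n).
have cvS : S n @[n --> \oo] --> limn a.
  rewrite -[X in _ --> X]subr0 (_ : S = (fun n => a n - 2 * C * 2^-1 ^+ n)); last first.
    by apply/funext => n; rewrite /a addrK.
  by apply: cvgB => //; exact: cvg_half.
have cvb : b n @[n --> \oo] --> limn a.
  by rewrite -[X in _ --> X]subr0; apply: cvgB => //; exact: cvg_half.
have -> : limn S = limn a by apply: cvg_lim => //; exact: Rhausdorff.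
split=> // n; rewrite ler_norml; apply/andP; split.
- have : b n <= limn a.
    rewrite -(cvg_lim (@Rhausdorff _) cvb).
    by apply: nondecreasing_cvgn_le => //; exact: cvgP cvb.
  by rewrite /b; lra.
- have : limn a <= a n by exact: nonincreasing_cvgn_ge.
  by rewrite /a; lra.
Qed.

End geometric.

(** * Resolvent of a Markov kernel *)

Section markov_resolvent.
Implicit Types (n : nat).
Context d (X : measurableType d) (R : realType) (mu : probability X R).
Variables (k : X -> X -> R) (M : R).
Hypothesis bk : bounded_kernel M k.
Hypothesis k_ge0 : forall x y, 0 <= k x y.
Hypothesis k_mass : forall y, \int[mu]_x k x y = 1.
Notation L := (kernel_op mu k).
(** A1 in the form used here: decay in [L1], for bounded functions of zero mean such as the
    differences of two columns of [k]. *)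
Hypothesis decay : forall (C : R) (g : X -> R),
  measurable_fun setT g -> (forall x, `|g x| <= C) ->
  \int[mu]_x g x = 0 -> \int[mu]_x `|iter n L g x| @[n --> \oo] --> (0 : R).

Notation L1 f := (mu.-integrable setT (EFin \o f)).

Let i1 : L1 (cst (1 : R)). Proof. exact: finite_measure_integrable_cst. Qed.

(** The adjoint of a kernel whose columns have mass one fixes the constant [1]. *)
Lemma Rintegral_markov v : L1 v -> \int[mu]_x L v x = \int[mu]_x v x.
Proof.
move=> iv.
have := kernel_op_adjoint bk i1 iv.
rewrite /kernel_op; under eq_Rintegral do rewrite mul1r.
move=> ->; apply: eq_Rintegral => y _.
by under eq_Rintegral do rewrite mulr1; rewrite k_mass mulr1.
Qed.

(** Positivity of [k] gives [|L v| <= L |v|] pointwise, and [L] conserves the mass of [|v|]. *)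
Lemma markov_contraction v : L1 v -> \int[mu]_x `|L v x| <= \int[mu]_x `|v x|.
Proof.
move=> iv; have iv' := integrable_normr iv.
rewrite -(Rintegral_markov iv'); apply: le_RintegralT.
- exact: integrable_normr (kernel_op_integrable bk iv).
- exact: kernel_op_integrable bk iv'.
- move=> x; have ikv := kernel_op_integrand x bk iv.
  apply: le_trans (le_normr_Rintegral measurableT ikv) _.
  rewrite le_eqVlt; apply/orP; left; apply/eqP; apply: eq_Rintegral => y _.
  by rewrite normrM ger0_norm.
Qed.

Lemma iter_integrable n v : L1 v -> L1 (iter n L v).
Proof. by move=> iv; elim: n => [//|n IH] /=; exact: kernel_op_integrable bk IH. Qed.

Lemma iter_contraction n v : L1 v ->
  \int[mu]_x `|iter n L v x| <= \int[mu]_x `|v x|.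
Proof.
move=> iv; elim: n => [//|n IH] /=; apply: le_trans IH.
exact: markov_contraction (iter_integrable n iv).
Qed.

Lemma Rintegral_iter n v : L1 v -> \int[mu]_x iter n L v x = \int[mu]_x v x.
Proof.
move=> iv; elim: n => [//|n <-] /=.
exact: Rintegral_markov (iter_integrable n iv).
Qed.

Lemma bounded_kernel_iter C q n : bounded_kernel C q ->
  bounded_kernel (M ^+ n * C) (iter n (kernel_comp mu k) q).
Proof.
move=> bq; elim: n => [|n IH] /=; first by rewrite mul1r.
by rewrite exprS -mulrA; exact: bounded_kernel_comp.
Qed.

Lemma iter_kernel_comp n q y x :
  iter n (kernel_comp mu k) q x y = iter n L (q ^~ y) x.
Proof.
elim: n x => [//|n IH] x /=; rewrite /kernel_comp /kernel_op.
by apply: eq_Rintegral => z _; rewrite IH.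
Qed.

Lemma iter_kernel_op C q n v x : bounded_kernel C q -> L1 v ->
  iter n L (kernel_op mu q v) x = kernel_op mu (iter n (kernel_comp mu k) q) v x.
Proof.
move=> bq iv; elim: n x => [//|n IH] x /=.
rewrite -(kernel_opA _ bk (bounded_kernel_iter n bq) iv).
by rewrite /kernel_op; apply: eq_Rintegral => z _; rewrite IH.
Qed.

(* Centering the columns of [k] does not change its action on functions of zero
   mean, while each centered column decays under iteration of [L]. *)
Let D x z := k x z - k x point.

Let bD : bounded_kernel (M + M) D.
Proof.
split=> [|x y]; last by rewrite (le_trans (ler_normB _ _))// lerD// bk.2.
apply: measurable_funB; first exact: bk.1.
by apply: measurableT_comp (bounded_kernel_col point bk) _.
Qed.

Let Dn n := iter n (kernel_comp mu k) D.
Let delta n := \int[mu]_z \int[mu]_x `|Dn n x z|.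

Let mDn n : measurable_fun setT (fun z => \int[mu]_x `|Dn n x z|).
Proof.
apply: (measurable_Rintegral mu (F := fun p : X * X => `|Dn n p.2 p.1|)).
exact: measurableT_comp (bounded_kernelT (bounded_kernel_iter n bD)).1.
Qed.

Let Dn_le n z : `|\int[mu]_x `|Dn n x z| | <= M + M.
Proof.
rewrite ger0_norm; last exact: Rintegral_ge0.
under eq_Rintegral do rewrite /Dn iter_kernel_comp.
apply: le_trans (iter_contraction n (bounded_kernel_col_int mu z bD)) _.
by apply: Rintegral_norm_le (bounded_kernel_col z bD) _ => x; exact: bD.2.
Qed.

(** The columns of [D] have zero mean because those of [k] all have the same mass, so [decay]
    applies to each; the [L1] contraction supplies the dominating constant [M + M]. *)
Let delta_cvg : delta n @[n --> \oo] --> (0 : R).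
Proof.
have h := @dominated_cvg _ X R mu setT measurableT
  (fun n z => (\int[mu]_x `|Dn n x z|)%:E) (cst 0%E) (cst (M + M)%:E).
rewrite -[X in _ --> X](_ : fine 0%E = 0)//.
apply: (@fine_cvg _ _ _ _ _ (0 : R)).
rewrite -[X in _ --> X](@integral0 _ _ _ mu setT).
apply: h => //.
- by move=> n; apply/measurable_EFinP; exact: mDn.
- move=> z _ /=; apply: cvg_EFin; first by near=> n.
  under eq_fun do under eq_Rintegral do rewrite /Dn iter_kernel_comp.
  apply: (decay (C := M + M)); first exact: bounded_kernel_col bD.
    by move=> x; exact: bD.2.
  rewrite RintegralB//; do ?exact: bounded_kernel_col_int bk.
  by rewrite !k_mass subrr.
- exact: finite_measure_integrable_cst.
- by move=> n z _; rewrite lee_fin Dn_le.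
Unshelve. all: by end_near. Qed.

Let op_centered g x : L1 g -> \int[mu]_x g x = 0 -> L g x = kernel_op mu D g x.
Proof.
move=> ig g0; rewrite /kernel_op /D.
under [RHS]eq_Rintegral do rewrite mulrBl.
rewrite RintegralB//; last 2 first.
- exact: kernel_op_integrand bk ig.
- exact: (integrableZl measurableT (k x point) (f := fun y => (g y)%:E)).
by rewrite RintegralZl// g0 mulr0 subr0.
Qed.

(** Of the [n.+2] applications of [L], the first turns [g] into an average of columns of [D], the
    next [n] act on these columns, and the last turns the resulting [L1] bound into a uniform one at
    the cost of a factor [M]. *)
Let iter_delta n (C : R) (g : X -> R) x : measurable_fun setT g -> (forall x, `|g x| <= C) ->
  \int[mu]_x g x = 0 -> `|iter n.+2 L g x| <= M * (C * delta n).
Proof.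
move=> mg gC g0; have ig := integrable_le_cst mu mg gC.
have M0 := bounded_kernel_ge0 bk.
have bDn := bounded_kernel_iter n bD.
have bDn' : bounded_kernel (M ^+ n * (M + M)) (fun x z => `|Dn n x z|).
  by split=> [|a b]; [exact: measurableT_comp bDn.1|rewrite normr_id bDn.2].
rewrite [iter n.+2 _ _]/(L (iter n.+1 L g)).
apply: le_trans (kernel_op_le x bk (iter_integrable n.+1 ig)) _.
apply: ler_wpM2l => //.
have E y : iter n.+1 L g y = kernel_op mu (Dn n) g y.
  rewrite iterSr -(iter_kernel_op n _ bD ig); congr (iter n L _ y).
  by apply/funext => z; exact: op_centered.
under eq_Rintegral do rewrite E.
apply: (@le_trans _ _ (\int[mu]_y (C * kernel_op mu (fun x z => `|Dn n x z|) (cst 1) y))).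
  apply: le_RintegralT.
  - exact: integrable_normr (kernel_op_integrable bDn ig).
  - apply: (integrableZl measurableT C
      (f := fun y => (kernel_op mu (fun x z => `|Dn n x z|) (cst 1) y)%:E)).
    exact: kernel_op_integrable bDn' i1.
  move=> y; have ib := kernel_op_integrand y bDn ig.
  apply: le_trans (le_normr_Rintegral measurableT ib) _.
  rewrite -RintegralZl//; last exact: kernel_op_integrand bDn' i1.
  apply: le_RintegralT => //.
  - exact: (integrable_normr ib).
  - apply: (integrableZl measurableT C (f := fun z => (`|Dn n y z| * 1)%:E)).
    exact: kernel_op_integrand bDn' i1.
  - by move=> z; rewrite normrM mulr1 mulrC ler_wpM2r.
rewrite RintegralZl//; last exact: kernel_op_integrable bDn' i1.
apply: ler_wpM2l; first exact: le_trans (normr_ge0 _) (gC point).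
(* Exchanging the order of integration, with both test functions equal to [1], produces
   [delta n]. *)
have := kernel_op_adjoint bDn' i1 i1.
under eq_Rintegral do rewrite mul1r.
move=> ->; under eq_Rintegral do rewrite mul1r.
by rewrite /delta /kernel_op; under eq_Rintegral do under eq_Rintegral do rewrite mulr1.
Qed.

Lemma markov_halving : exists n, forall (C : R) (g : X -> R) x, measurable_fun setT g ->
  (forall x, `|g x| <= C) -> \int[mu]_x g x = 0 -> `|iter n L g x| <= C / 2.
Proof.
have M0 := bounded_kernel_ge0 bk.
(* [M + 1] instead of [M] keeps the threshold positive when [M = 0]. *)
have e0 : 0 < (2 * (M + 1))^-1 by rewrite invr_gt0; lra.
have /cvgrPdist_le/(_ _ e0) [n _ /(_ n (leqnn n))] := delta_cvg.
rewrite sub0r normrN => dn; exists n.+2 => C g x mg gC g0.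
apply: le_trans (iter_delta n x mg gC g0) _.
have C0 := le_trans (normr_ge0 _) (gC point).
rewrite mulrCA ler_wpM2l//.
apply: (@le_trans _ _ ((M + 1) * (2 * (M + 1))^-1)); last first.
  by rewrite invfM mulrCA mulfV ?mulr1//; lra.
have d0 : 0 <= delta n by apply: Rintegral_ge0 => z _; exact: Rintegral_ge0.
apply: ler_pM => //; first lra.
exact: le_trans (ler_norm _) dn.
Qed.

(** [H] is the Neumann series of [q], column by column. Summed in blocks of [n0] terms it converges
    geometrically, uniformly in both variables, since [n0] applications of [L] halve a uniform bound
    on functions of zero mean. *)
Lemma resolvent_kernel C q : bounded_kernel C q ->
  (forall y, \int[mu]_x q x y = 0) ->
  exists N H, [/\ bounded_kernel N H, forall y, \int[mu]_x H x y = 0 &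
    forall x y, H x y - L (H ^~ y) x = q x y].
Proof.
move=> bq q0; have [n0 half] := markov_halving.
have M0 := bounded_kernel_ge0 bk; have C0 := bounded_kernel_ge0 bq.
pose qm m := iter m (kernel_comp mu k) q.
have bqm m : bounded_kernel (M ^+ m * C) (qm m) by exact: bounded_kernel_iter.
have iqm m y : L1 (qm m ^~ y) by exact: bounded_kernel_col_int (bqm m).
have qm0 m y : \int[mu]_x qm m x y = 0.
  under eq_Rintegral do rewrite /qm iter_kernel_comp.
  by rewrite Rintegral_iter//; exact: bounded_kernel_col_int bq.
(* A common bound for the terms [qm i] with [i <= n0]: the powers of [1 + M] increase, whereas those
   of [M] may not. *)
pose B := (1 + M) ^+ n0 * C.
have qmB j i x y : (i <= n0)%N -> `|qm (j * n0 + i)%N x y| <= B * 2^-1 ^+ j.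
  move=> i0; elim: j x => [|j IH] x.
    rewrite mul0n expr0 mulr1; apply: le_trans ((bqm i).2 x y) _.
    rewrite ler_wpM2r// (@le_trans _ _ ((1 + M) ^+ i))//.
      by rewrite lerXn2r// ?nnegrE//; lra.
    by rewrite ler_weXn2l//; lra.
  rewrite mulSn -addnA /qm iterD iter_kernel_comp exprSr mulrA.
  apply: half; [exact: (bounded_kernel_col y (bqm (j * n0 + i)%N))|exact: IH|exact: qm0].
pose P N x y := \sum_(0 <= m < N) qm m x y.
have PS N x y : P N.+1 x y = P N x y + qm N x y by rewrite /P big_nat_recr.
have mP N : measurable_fun setT (fun p : X * X => P N p.1 p.2).
  by apply: measurable_sum => m; exact: (bqm m).1.
have iP N y : L1 (P N ^~ y).
  elim: N => [|N IH].
    rewrite (_ : P 0 ^~ y = cst 0); first exact: finite_measure_integrable_cst.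
    by apply/funext => x; rewrite /P big_geq.
  rewrite (_ : P N.+1 ^~ y = fun x => P N x y + qm N x y).
    exact: (integrableD measurableT IH (iqm N y)).
  by apply/funext => x; rewrite PS.
have P0 N y : \int[mu]_x P N x y = 0.
  elim: N => [|N IH].
    by rewrite /P; under eq_Rintegral do rewrite big_geq//; exact: Rintegral_cstT.
  under eq_Rintegral do rewrite PS.
  by rewrite RintegralD//= IH qm0 addr0.
(* Telescoping: [L] sends each term of the series to the next one. *)
have PL N x y : P N x y - L (P N ^~ y) x = q x y - qm N x y.
  elim: N => [|N IH].
    rewrite /P big_geq// /kernel_op.
    under eq_Rintegral do rewrite big_geq// mulr0.
    by rewrite Rintegral_cstT subr0 subrr.
  rewrite PS.
  have -> : L (P N.+1 ^~ y) x = L (P N ^~ y) x + qm N.+1 x y.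
    rewrite {1}/kernel_op; under eq_Rintegral do rewrite PS mulrDr.
    rewrite RintegralD//; last 2 first.
    - exact: (kernel_op_integrand x bk (iP N y)).
    - exact: (kernel_op_integrand x bk (iqm N y)).
  by rewrite opprD addrACA IH addrA subrK.
(* Only the partial sums that stop at multiples of [n0] are followed, so that one increment is a
   whole block. *)
pose S x y j := P (j * n0)%N x y.
have SB x y j : `|S x y j.+1 - S x y j| <= (n0%:R * B) * 2^-1 ^+ j.
  rewrite /S /P [X in X - _](@big_cat_nat _ _ _ (j * n0)%N)/=; [|by []|exact: leq_mul].
  rewrite addrAC subrr add0r.
  apply: le_trans (ler_norm_sum _ _ _) _.
  apply: (@le_trans _ _ (\sum_(j * n0 <= i < j.+1 * n0) (B * 2^-1 ^+ j))).
    rewrite big_nat_cond [leRHS]big_nat_cond; apply: ler_sum => i.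
    rewrite andbT => /andP[ji ij]; rewrite -(subnKC ji); apply: qmB.
    by rewrite leq_subLR; move: ij; rewrite mulSn addnC => /ltnW.
  by rewrite sumr_const_nat mulSn addnK -mulrA mulr_natl.
have SH x y := geometric_cvg (SB x y).
pose H x y := limn (S x y).
pose E := 2 * (n0%:R * B).
have bH : bounded_kernel E H.
  split=> [|x y].
    apply: (measurable_fun_cvg (h := fun j p => S p.1 p.2 j)) => [j|p _].
      exact: mP.
    exact: (SH p.1 p.2).1.
  have := (SH x y).2 0; rewrite expr0 mulr1 {2}/S mul0n /P big_geq// subr0.
  exact.
have iH y : L1 (H ^~ y) by exact: bounded_kernel_col_int bH.
have HP j y : \int[mu]_x `|H x y - S x y j| <= E * 2^-1 ^+ j.
  apply: Rintegral_norm_le => [|x]; last exact: (SH x y).2.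
  apply: measurable_funB; first exact: bounded_kernel_col bH.
  exact: measurableT_comp (mP _) (pair2_measurable y).
exists E, H; split=> // [y|x y].
- apply: (@le_half_eq0 _ E) => j.
  rewrite -[X in `|X|]subr0 -(P0 (j * n0)%N y) -RintegralB;
    [|exact: measurableT|exact: iH|exact: iP].
  apply: le_trans (HP j y); apply: le_normr_Rintegral => //.
  exact: (integrableB measurableT (iH y) (iP _ y)).
- apply/eqP; rewrite -subr_eq0; apply/eqP.
  (* The three constants bound the distance from [H] to the partial sum, the image of that
     difference under [L], and the term [qm (j * n0)] left over by telescoping. *)
  apply: (@le_half_eq0 _ (E + M * E + B)) => j.
  have -> : H x y - L (H ^~ y) x - q x y =
      (H x y - S x y j) - L (fun z => H z y - S z y j) x - qm (j * n0)%N x y.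
    have -> : L (fun z => H z y - S z y j) x = L (H ^~ y) x - L (P (j * n0)%N ^~ y) x.
      rewrite {1}/kernel_op; under eq_Rintegral do rewrite mulrBr.
      rewrite RintegralB//.
      - exact: (kernel_op_integrand x bk (iH y)).
      - exact: (kernel_op_integrand x bk (iP _ y)).
    by have := PL (j * n0)%N x y; rewrite -/(S x y j); lra.
  rewrite !mulrDl; apply: le_trans (ler_normB _ _) _; apply: lerD; last first.
    by have := @qmB j 0 x y (leq0n _); rewrite addn0.
  apply: le_trans (ler_normB _ _) _; apply: lerD; first exact: (SH x y).2.
  have iHS : L1 (fun z => H z y - S z y j).
    exact: (integrableB measurableT (iH y) (iP _ y)).
  apply: le_trans (kernel_op_le x bk iHS) _.
  by rewrite -mulrA ler_wpM2l.
Qed.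

End markov_resolvent.

(** * Derivatives of Lipschitz functions *)

Section derivative_measurability.
Variables (R : realType) (f : R -> R).
Hypothesis cf : continuous f.

Let quot x h := h^-1 *: (f (h + x) - f x).

Let derive1_cvg_set := [set x | cvg (quot x @ 0^')].

(** A Cauchy condition on the difference quotients, with precision [1/(m+1)] and scale [1/(n+1)].
    The bound on the oscillation is non-strict so that, [f] being continuous, the set is closed. *)
Let oscillation_le m n := [set x | forall h h', h != 0 -> h' != 0 ->
  `|h| < n.+1%:R^-1 -> `|h'| < n.+1%:R^-1 ->
  `|quot x h - quot x h'| <= m.+1%:R^-1].

Let closed_oscillation m n : closed (oscillation_le m n).
Proof.
rewrite (_ : oscillation_le m n = \bigcap_(p in [set p : R * R |
    [/\ p.1 != 0, p.2 != 0, `|p.1| < n.+1%:R^-1 & `|p.2| < n.+1%:R^-1]])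
    ((fun x => `|quot x p.1 - quot x p.2|) @^-1` [set y | y <= m.+1%:R^-1])).
  apply: closed_bigI => -[h h'] _.
  apply: (preimage_closed (f := fun x => `|quot x h - quot x h'|)
    (D := [set y | y <= m.+1%:R^-1])); last exact: closed_le.
  have cq t : continuous (quot ^~ t).
    move=> x; apply: (@cvgZl_tmp _ _ _ _ _ t^-1 (fun z => f (t + z) - f z)).
    apply: cvgB; last exact: cf.
    by apply: continuous_comp; [apply: cvgD; [exact: cvg_cst|exact: cvg_id]|exact: cf].
  by move=> x _; apply: cvg_norm; apply: cvgB; exact: cq.
apply/seteqP; split=> [x H [h h'] /= [? ? ? ?]|x H h h' ? ? ? ?]; first exact: H.
by have := H (h, h'); apply; split.
Qed.

Let derive1_cvg_setE : derive1_cvg_set = \bigcap_m \bigcup_n oscillation_le m n.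
Proof.
apply/seteqP; split=> x /=.
- move=> /cvg_ex[l /cvgrPdist_le ql] m _.
  have e0 : 0 < m.+1%:R^-1 / 2 :> R by rewrite divr_gt0// invr_gt0.
  have /nbhs_ballP [e /= e_gt0 eq] := ql _ e0.
  have [n _ /(_ n (leqnn n)) ne] := near_infty_natSinv_lt (PosNum e_gt0).
  have near_l h : h != 0 -> `|h| < n.+1%:R^-1 -> `|l - quot x h| <= m.+1%:R^-1 / 2.
    move=> h0 hn; apply: eq => //.
    by rewrite /ball/= sub0r normrN (lt_trans hn).
  exists n => // h h' h0 h'0 hn h'n.
  rewrite -(subrKA l) (le_trans (ler_normD _ _))// (splitr m.+1%:R^-1) lerD//.
    by rewrite distrC near_l.
  exact: near_l.
- move=> H; apply: cauchy_cvg; apply: cauchy_exP => e e0.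
  have [m _ /(_ m (leqnn m)) me] := near_infty_natSinv_lt (PosNum e0).
  have [n _ Hn] := H m I.
  have n0 : 0 < n.+1%:R^-1 :> R by rewrite invr_gt0.
  have n20 : 0 < n.+1%:R^-1 / 2 :> R by rewrite divr_gt0.
  exists (quot x (n.+1%:R^-1 / 2)).
  suff : \forall h \near (0 : R)^', ball (quot x (n.+1%:R^-1 / 2)) e (quot x h) by [].
  near=> h; rewrite /ball/=; apply: le_lt_trans me; apply: Hn.
  + by rewrite gt_eqF.
  + by near: h; exact: nbhs_dnbhs_neq.
  + by rewrite gtr0_norm// gtr_pMr// invf_lt1// ltr1n.
  + by near: h; apply: dnbhs0_lt.
Unshelve. all: by end_near. Qed.

(** By the Cauchy criterion the points of differentiability form a countable intersection of
    countable unions of closed sets. There the derivative is the limit of the quotients with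
    increments [1/(n+1)]; elsewhere it is the constant default of [lim]. *)
Lemma measurable_derive1 : measurable_fun setT f^`()%classic.
Proof.
have mD : measurable derive1_cvg_set.
  rewrite derive1_cvg_setE; apply: bigcap_measurable => [|m _].
    by exists 0%N.
  apply: bigcup_measurable => n _; by apply: closed_measurable; exact: closed_oscillation.
rewrite -(setUv derive1_cvg_set); apply/measurable_funU => //.
  exact: measurableC.
split.
- apply: (measurable_fun_cvg (h := fun n x => quot x n.+1%:R^-1)) => [n|x Dx].
    apply: measurable_funTS; apply: measurable_funM => //.
    apply: measurable_funB; last exact: continuous_measurable_fun.
    apply: measurableT_comp; first exact: continuous_measurable_fun.
    exact: measurable_funD.
  have : quot x @ 0^' --> f^`()%classic x by exact: Dx.
  move=> /cvg_dnbhs_at_right/cvg_at_rightP; apply; split=> [n|].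
    by rewrite invr_gt0.
  exact: cvg_harmonic.
- apply: (eq_measurable_fun (cst (point : R))) => // x.
  rewrite inE => /= Dx; rewrite /derive1.
  by rewrite /lim /lim_in /= xgetPN// => l /cvgP.
Qed.

End derivative_measurability.

Section lipschitz.
Variables (R : realType) (f : R -> R) (K : R).
Hypothesis K_gt0 : 0 < K.
Hypothesis fK : forall x y, `|f x - f y| <= K * `|x - y|.
Notation lambda := (@lebesgue_measure R).

Lemma lipschitz_continuous : continuous f.
Proof.
move=> x; apply/cvgrPdist_le => e e0; near=> y.
apply: le_trans (fK x y) _; rewrite -ler_pdivlMl// mulrC.
near: y; apply: cvgr_dist_le; first exact: cvg_id.
by rewrite divr_gt0.
Unshelve. all: by end_near. Qed.

(** [|point|] covers the points without derivative, where [lim] returns its default. A bound at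
    every point is what a bounded kernel asks for. *)
Lemma derive1_lipschitz_le x : `|f^`()%classic x| <= Num.max K `|point : R|.
Proof.
have [cq|ncq] := pselect (cvg ((fun h => h^-1 *: (f (h + x) - f x)) @ 0^')).
  rewrite le_max; apply/orP; left.
  have : `|h^-1 *: (f (h + x) - f x)| @[h --> 0^'] --> `|f^`()%classic x|.
    by apply: cvg_norm; exact: cq.
  move=> cl; rewrite -(cvg_lim (@Rhausdorff _) cl); apply: limr_le; first exact: cvgP cl.
  near=> h.
  have h0 : h != 0 by near: h; exact: nbhs_dnbhs_neq.
  rewrite normrZ normfV ler_pdivrMl ?normr_gt0// mulrC.
  by apply: le_trans (fK _ _) _; rewrite addrK.
rewrite le_max; apply/orP; right.
by rewrite /derive1 /lim /lim_in /= xgetPN// => l /cvgP.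
Unshelve. all: by end_near. Qed.

(** Tilting by the slope [K] produces nondecreasing functions, hence Stieltjes measures. Despite its
    name, [g'] is not a derivative: it is the companion of [g] for which
    [g x + g' x = 2 * K * x]. *)
Let g x := f x + K * x.
Let g' x := K * x - f x.

Let g_nd : nondecreasing g.
Proof.
move=> x y xy; have := fK x y; rewrite ler_norml => /andP[_].
by rewrite distrC ger0_norm ?subr_ge0// /g; lra.
Qed.

Let g'_nd : nondecreasing g'.
Proof.
move=> x y xy; have := fK x y; rewrite ler_norml => /andP[+ _].
by rewrite distrC ger0_norm ?subr_ge0// /g'; lra.
Qed.

Let linear_continuous : continuous (fun x : R => K * x).
Proof. by move=> x; apply: cvgMr; exact: cvg_id. Qed.

Let g_rc : right_continuous g.
Proof.
apply: right_continuousW => x; apply: cvgD; first exact: lipschitz_continuous.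
exact: linear_continuous.
Qed.

Let g'_rc : right_continuous g'.
Proof.
apply: right_continuousW => x; apply: cvgB; last exact: lipschitz_continuous.
exact: linear_continuous.
Qed.

HB.instance Definition _ := isCumulative.Build R _ R g g_nd g_rc.
HB.instance Definition _ := isCumulative.Build R _ R g' g'_nd g'_rc.

Let nu := lebesgue_stieltjes_measure g.
Let nu' := lebesgue_stieltjes_measure g'.

Let stieltjes_ocitv (F : cumulative R R) (a b : R) : a <= b ->
  lebesgue_stieltjes_measure F `]a, b]%classic = (F b - F a)%:E.
Proof.
move=> ab; rewrite /lebesgue_stieltjes_measure/= /measure_extension/=.
rewrite measurable_mu_extE//; last exact: is_ocitv.
exact: wlength_itv_bnd.
Qed.

(* [g] and [2 K x - g] are both nondecreasing, so [dg <= 2 K dx]. *)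
Let stieltjes_add A : measurable A -> (nu A + nu' A = (2 * K)%:E * lambda A)%E.
Proof.
have K2 : 0 <= (2 * K)^-1 by rewrite invr_ge0 mulr_ge0 ?ltW.
(* [m] is the sum of both measures divided by [2 * K]; it agrees with Lebesgue measure on half-open
   intervals, hence on all measurable sets. *)
pose m := mscale (NngNum K2) (measure_add nu nu').
have mE : forall X, ocitv X -> lambda X = m X.
  move=> X /ocitvP[->|[[a b] /= ab ->]]; first by rewrite !measure0.
  rewrite /m /mscale /= /msum !big_ord_recl big_ord0 /= adde0.
  rewrite /nu /nu' /= !stieltjes_ocitv ?ltW//.
  rewrite lebesgue_measure_itv/= lte_fin ab -EFinB -EFinD -EFinM /g /g'.
  by congr EFin; field; rewrite gt_eqF.
move=> mA; have -> := lebesgue_measure_unique mE mA.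
rewrite /m /= /mscale /= /msum !big_ord_recl big_ord0 /= adde0 muleA -EFinM mulfV ?mul1e//.
by rewrite mulf_neq0// gt_eqF.
Qed.

Let nu_dominated : nu `<< lambda.
Proof.
apply/null_content_dominatesP => A mA A0.
have := stieltjes_add mA; rewrite A0 mule0 => /eqP.
by rewrite padde_eq0// => /andP[/eqP].
Qed.

(** [phi] is the Radon-Nikodym density of the Stieltjes measure of [g] on []a, b]]. Its primitive is
    [g - g a] there, so Lebesgue differentiation identifies [phi] almost everywhere with the
    derivative of [f x + K * x]. *)
Lemma lipschitz_primitive a b : a < b -> exists phi : R -> R,
  [/\ lambda.-integrable setT (EFin \o phi),
      {ae lambda, forall x, a < x < b -> f^`()%classic x = phi x - K} &
      \int[lambda]_(x in `]a, b]) phi x = f b - f a + K * (b - a)].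
Proof.
move=> ab.
have nu_ab : (nu `]a, b]%classic < +oo)%E by rewrite /nu stieltjes_ocitv ?ltW// ltry.
pose mab := measurable_itv `]a, b] : measurable (`]a, b]%classic : set (measurableTypeR R)).
(* Restricting to []a, b]] provides the finite measure to which Radon-Nikodym is applied. *)
pose nuab : {finite_measure set _ -> \bar R} := mfrestr mab nu_ab.
have nuab_dom : nuab `<< lambda.
  apply/null_content_dominatesP => A mA A0.
  move/null_content_dominatesP : nu_dominated; apply; first exact: measurableI.
  apply/eqP; rewrite eq_le measure_ge0 andbT -[leRHS]A0.
  by apply: le_measure; rewrite ?inE//; exact: measurableI.
have [psi [psi0 psif ipsi nuE]] := radon_nikodym_sigma_finite nuab_dom.
pose phi x := fine (psi x).
have psiE : EFin \o phi = psi by apply/funext => x; rewrite /phi/= fineK.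
have iphi : lambda.-integrable setT (EFin \o phi) by rewrite psiE.
have intE x : a <= x -> x <= b -> \int[lambda]_(t in `]a, x]) phi t = g x - g a.
  move=> ax xb; transitivity (fine (\int[lambda]_(t in `]a, x]) psi t)).
    by rewrite -psiE.
  rewrite -nuE//=.
  rewrite /mfrestr /mrestr setIidl; last by apply: subset_itv; rewrite bnd_simp.
  by rewrite stieltjes_ocitv.
exists phi; split=> //; last by rewrite intE ?lexx ?(ltW ab)// /g; ring.
have := @FTC1 R phi (BRight a).
have iphi_y y : lambda.-integrable [set` Interval (BRight a) (BRight y)] (EFin \o phi).
  by apply: integrableS iphi => //; exact: measurable_itv.
move=> /(_ iphi_y).
move=> /(_ (open_integrable_locally openT iphi)).
apply: filterS; first exact: (ae_filter_ringOfSetsType lambda).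
move=> x H /andP[ax xb].
have [dF FE] := H ax.
rewrite -FE.
set F := (fun y => \int[lambda]_(t in [set` Interval (BRight a) (BRight y)]) phi t)
  in dF FE *.
rewrite !derive1E.
have isF : is_derive x 1 F ('D_1 F x) by exact: derivableP.
(* Near [x], the function [f] differs from the primitive [F] by an affine function. *)
have fF : \near x, f x = F x + (g a - K * x).
  near=> z; rewrite /F intE; first by rewrite /g; lra.
    by near: z; apply: filterS (lt_nbhsr ax) => ? /ltW.
  by near: z; apply: filterS (lt_nbhsl xb) => ? /ltW.
rewrite (near_eq_derive _ fF) ?oner_eq0//.
have D : is_derive x 1 (fun z => F z + (g a - K *: z)) ('D_1 F x + (0 - K *: 1)).
  by apply: is_deriveD.
by rewrite (derive_val (is_derive := D)) sub0r /GRing.scale /= mulr1.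
Unshelve. all: by end_near. Qed.

Lemma Rintegral_derive1_lipschitz a b : a < b ->
  \int[lambda]_(x in `]a, b]) f^`()%classic x = f b - f a.
Proof.
move=> ab; have [phi [iphi fphi phiE]] := lipschitz_primitive ab.
have mf' : measurable_fun setT f^`()%classic.
  exact: measurable_derive1 lipschitz_continuous.
have mphi : measurable_fun setT phi by have /measurable_EFinP := measurable_int _ iphi.
transitivity (\int[lambda]_(x in `]a, b]) (phi x - K)).
  rewrite /Rintegral; congr fine; apply: ae_eq_integral => //.
  - by apply/measurable_EFinP; exact: measurable_funTS.
  - by apply/measurable_EFinP; apply: measurable_funTS; exact: measurable_funB.
  (* The derivative is identified on the open interval only, so the endpoint [b] is discarded. *)
  have nb : {ae lambda, forall x : measurableTypeR R, x != b}.
    exists [set b]; split=> //; first exact: lebesgue_measure_set1.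
    by move=> x /= /negP; rewrite negbK => /eqP.
  have aeF := ae_filter_ringOfSetsType lambda.
  apply: filterS2 fphi nb => x + xb; rewrite /= in_itv/= => H /andP[ax xb'].
  by congr EFin; apply: H; rewrite ax lt_neqAle xb.
rewrite RintegralB//; last 2 first.
- exact: integrableS iphi.
- apply: measurable_bounded_integrable => //.
    by rewrite /= lebesgue_measure_itv/= lte_fin ab ltry.
  exists K; split; first exact: num_real.
  by move=> y Ky x _; rewrite gtr0_norm ?ltW.
rewrite phiE Rintegral_cst//= lebesgue_measure_itv/= lte_fin ab.
by rewrite /=; lra.
Qed.

End lipschitz.

(** * Folding onto the unit interval *)

Section mu01_facts.
Variable R : realType.
Notation lambda := (@lebesgue_measure R).

Lemma mu01_setT : mu01 R setT = 1%E.
Proof.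
by rewrite /mu01 /= /mrestr setTI lebesgue_measure_itv /= lte_fin ltr01 -EFinB subr0.
Qed.

(** [mu01] with its total mass recorded, so that the results on kernels over a probability space
    apply. *)
Definition prob01 : probability (measurableTypeR R) R :=
  HB.pack (Measure.sort (mu01 R)) (Measure_isProbability.Build _ _ _ (mu01 R) mu01_setT).

Lemma ae_mu01 (P : R -> Prop) : (forall x, x \in `[0, 1] -> P x) ->
  {ae mu01 R, forall x, P x}.
Proof.
move=> P01; exists (~` `[0, 1]); split.
- exact: measurableC.
- by rewrite /mu01 /= /mrestr setICl measure0.
- by move=> x /= nP x01; apply: nP; exact: P01.
Qed.

Lemma Rintegral_mu01 (f : R -> R) : measurable_fun setT f ->
  \int[lambda]_(x in `[0, 1]) f x = \int[mu01 R]_x f x.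
Proof.
move=> mf; pose g := f \_ `[0, 1].
have mg : measurable_fun setT g by apply/measurable_restrict => //; exact: measurable_funTS.
rewrite Rintegral_mkcond -/g /Rintegral; congr fine.
transitivity (\int[mu01 R]_x (g x)%:E)%E; last first.
  apply: ae_eq_integral => //; [exact/measurable_EFinP|exact/measurable_EFinP|].
  by apply: ae_mu01 => x x01 _ /=; rewrite /g patchE mem_set.
have gE : EFin \o g = (EFin \o g) \_ `[0, 1].
  by apply/funext => x; rewrite /= /g !patchE; case: ifPn => xD //=; rewrite patchE xD.
rewrite -/(EFin \o g) gE -!integral_mkcond.
apply: eq_measure_integral => A mA AD.
by rewrite /mu01 /= /mrestr setIidl.
Qed.

End mu01_facts.

Section lebesgue_isometry.
Variables (R : realType) (f : R -> R) (M : R).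
Hypothesis mf : measurable_fun setT f.
Hypothesis fM : forall x, `|f x| <= M.
Notation lambda := (@lebesgue_measure R).
Notation I a b := (\int[lambda]_(x in `]a, b]) f x).

Lemma bounded_itv_integrable (g : R -> R) (a b : R) (c d : bool) :
  measurable_fun setT g -> (forall x, `|g x| <= M) ->
  lambda.-integrable [set` Interval (BSide c a) (BSide d b)] (EFin \o g).
Proof.
move=> mg gM; apply: measurable_bounded_integrable => //.
- rewrite /= lebesgue_measure_itv/=; case: ifPn => _; rewrite ?ltry//.
- exact: measurable_funTS.
- exists M; split; first exact: num_real.
  by move=> y My x _; exact: le_trans (gM x) (ltW My).
Qed.

Lemma Rintegral_itv_cat a b c : a <= b -> b <= c -> I a b + I b c = I a c.
Proof.
move=> ab bc; rewrite -(@Rintegral_itvB _ f (BRight a) (BRight c) b) ?bnd_simp//.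
  by rewrite addrC subrK.
exact: bounded_itv_integrable.
Qed.

Lemma Rintegral_lebesgue_preserving (phi : R -> R) (a b : R) :
  measurable_fun (setT : set (measurableTypeR R)) (phi : _ -> measurableTypeR R) ->
  (forall A, measurable A -> lambda (phi @^-1` A) = lambda A) ->
  I a b = \int[lambda]_(x in phi @^-1` `]a, b]) f (phi x).
Proof.
move=> mphi lphi; rewrite /Rintegral; congr fine.
rewrite -(@integral_pushforward _ _ (measurableTypeR R) (measurableTypeR R) R phi mphi
   lambda `]a, b]%classic (EFin \o f))//.
- by apply: eq_measure_integral => A mA _; exact/esym/lphi.
- exact/measurable_EFinP.
- apply: measurable_bounded_integrable.
  + by rewrite -[X in measurable X]setTI; exact: mphi.
  + rewrite [ltLHS]lphi// lebesgue_measure_itv/=; case: ifPn => _; rewrite ?ltry//.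
  + by apply: measurable_funTS; apply: measurableT_comp.
  + exists M; split; first exact: num_real.
    by move=> y My x _; exact: le_trans (fM _) (ltW My).
Qed.

Lemma lebesgue_measure_shift (c : R) (A : set (measurableTypeR R)) : measurable A ->
  lambda ((fun x => c + x) @^-1` A) = lambda A.
Proof.
move=> mA.
have mc : measurable_fun (setT : set (measurableTypeR R))
    ((fun x : R => c + x) : measurableTypeR R -> measurableTypeR R).
  exact: measurable_funD.
apply/esym; apply: (@lebesgue_measure_unique R (pushforward lambda
  ((fun x : R => c + x) : measurableTypeR R -> measurableTypeR R))) => // _ [[a b] _ <-].
transitivity (lambda `]a - c, b - c]%classic).
  rewrite !lebesgue_measure_itv/= !lte_fin ltrD2r; case: ifPn => // _.
  by rewrite -!EFinB; congr EFin; lra.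
congr (lambda _).
by apply/seteqP; split=> x /=; rewrite !in_itv/=; lra.
Qed.

Lemma Rintegral_shift (c : R) :
  \int[lambda]_(x in `[0, 1]) f (c + x) = I c (c + 1).
Proof.
rewrite (Rintegral_lebesgue_preserving _ _ (phi := fun x => c + x)); last 2 first.
- exact: measurable_funD.
- exact: lebesgue_measure_shift.
(* The preimage of []c, c + 1]] is []0, 1]]; the missing endpoint [0] is negligible. *)
rewrite -Rintegral_itv_obnd_cbnd; last first.
  apply: bounded_itv_integrable => //.
  by apply: measurableT_comp => //; exact: measurable_funD.
congr Rintegral; apply/seteqP; split=> x /=; rewrite !in_itv/=; lra.
Qed.

Lemma Rintegral_reflect (c : R) :
  \int[lambda]_(x in `[0, 1]) f (c - x) = I (c - 1) c.
Proof.
rewrite (Rintegral_lebesgue_preserving _ _ (phi := fun x => c - x)); last 2 first.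
- exact: measurable_funB.
- move=> A mA; rewrite -[RHS](lebesgue_measure_shift c mA).
  have mA' : measurable ((fun x : measurableTypeR R => c + x : measurableTypeR R) @^-1` A).
    rewrite -[X in measurable X]setTI.
    by apply: (measurable_funD (measurable_cst c) (@measurable_id _ _ _)).
  exact: (lebesgue_measureN mA').
(* Reflection reverses orientation: the preimage of []c - 1, c]] is [[0, 1[], and the missing
   endpoint is now [1]. *)
rewrite -Rintegral_itv_bndo_bndc; last first.
  apply: bounded_itv_integrable => //.
  by apply: measurableT_comp => //; exact: measurable_funB.
congr Rintegral; apply/seteqP; split=> x /=; rewrite !in_itv/=; lra.
Qed.

Lemma Rintegral_support (a b : R) : (forall x, ~ (a < x <= b) -> f x = 0) ->
  I a b = \int[lambda]_x f x.
Proof.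
move=> f0; rewrite Rintegral_mkcond; apply: eq_Rintegral => x _.
rewrite patchE; case: ifPn => //; rewrite notin_setE /= in_itv/= => nx.
by rewrite f0.
Qed.

End lebesgue_isometry.

Section folding.
Variables (R : realType) (psi : R -> R) (M : R).
Hypothesis mpsi : measurable_fun setT psi.
Hypothesis psiM : forall x, `|psi x| <= M.
Hypothesis psi0 : forall x, 1 < `|x| -> psi x = 0.
Notation lambda := (@lebesgue_measure R).

(* For [psi] vanishing off [[-1, 1]] and [x], [T y] in [[0, 1]], only the indices
   [-2, 0, 2] contribute to [P_pi]. *)
Definition fold_kernel (f T : R -> R) (x y : R) : R :=
  (f (- 2 - T y + x) + f (- 2 - T y - x)) +
  ((f (- T y + x) + f (- T y - x)) + (f (2 - T y + x) + f (2 - T y - x))).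

Lemma P_pi_fold (T : R -> R) (x y : R) : x \in `[0, 1] -> T y \in `[0, 1] ->
  P_pi (tau (- T y) psi) x = fold_kernel psi T x y.
Proof.
rewrite !in_itv/= => /andP[x0 x1] /andP[b0 b1].
rewrite /P_pi (fsbigE [:: (-2)%Z; 0%Z; 2%Z])//.
- rewrite !big_cons big_nil !ifT ?inE//= addr0 /tau /fold_kernel.
  rewrite (_ : (-2)%:~R = -2 :> R)// (_ : 0%:~R = 0 :> R)// (_ : 2%:~R = 2 :> R)//.
  by congr (_ + _ + (_ + _ + (_ + _))); congr psi; ring.
- by move=> i /=; rewrite !inE => /or3P[] /eqP ->.
- move=> i /= di; rewrite !inE !negb_or => /and3P[i1 i2 i3].
  (* [i] is even. As [x] and [T y] lie in [[0, 1]], both arguments of [psi] then have absolute value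
     at least [2]. *)
  have : (4 <= i)%R \/ (i <= -4)%R by lia.
  rewrite /tau => -[i4|i4].
    have i4R : 4 <= i%:~R :> R by rewrite (_ : 4 = 4%:~R)// ler_int.
    rewrite !psi0 ?addr0//; rewrite ltr_normr; apply/orP; left; lra.
  have i4R : i%:~R <= -4 :> R by rewrite (_ : -4 = (-4)%:~R :> R) ?ler_int// mulrNz.
  rewrite !psi0 ?addr0//; rewrite ltr_normr; apply/orP; right; lra.
Qed.

Lemma bounded_kernel_fold (T : R -> R) : measurable_fun setT T ->
  bounded_kernel (X := measurableTypeR R) (6 * M) (fold_kernel psi T).
Proof.
move=> mT; split=> [|x y]; last first.
  apply: (@le_trans _ _ ((M + M) + ((M + M) + (M + M)))); last by lra.
  by rewrite /fold_kernel; do 5! rewrite (le_trans (ler_normD _ _))// lerD//.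
have m1 (c : R) : measurable_fun setT
    (fun p : measurableTypeR R * measurableTypeR R => psi (c - T p.2 + p.1)).
  apply: measurableT_comp => //; apply: measurable_funD => //.
  by apply: measurable_funB => //; exact: measurableT_comp.
have m2 (c : R) : measurable_fun setT
    (fun p : measurableTypeR R * measurableTypeR R => psi (c - T p.2 - p.1)).
  apply: measurableT_comp => //; apply: measurable_funB => //.
  by apply: measurable_funB => //; exact: measurableT_comp.
have m10 : measurable_fun setT
    (fun p : measurableTypeR R * measurableTypeR R => psi (- T p.2 + p.1)).
  by have := m1 0; under eq_fun do rewrite sub0r.
have m20 : measurable_fun setT
    (fun p : measurableTypeR R * measurableTypeR R => psi (- T p.2 - p.1)).
  by have := m2 0; under eq_fun do rewrite sub0r.
exact: (measurable_funD (measurable_funD (m1 _) (m2 _))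
  (measurable_funD (measurable_funD m10 m20) (measurable_funD (m1 _) (m2 _)))).
Qed.

(** The six terms integrate [psi] over the unit intervals that tile []- 3 - T y, 3 - T y]], which
    contains [[-1, 1]] since [T y] lies in [[0, 1]]. *)
Lemma Rintegral_fold (T : R -> R) (y : R) : measurable_fun setT T -> T y \in `[0, 1] ->
  \int[mu01 R]_x fold_kernel psi T x y = \int[lambda]_x psi x.
Proof.
move=> mT; rewrite in_itv/= => /andP[b0 b1].
rewrite -Rintegral_mu01; last exact: (bounded_kernel_col y (bounded_kernel_fold mT)).
have i1 (c : R) : lambda.-integrable `[0, 1] (EFin \o (fun x : R => psi (c + x))).
  apply: (@bounded_itv_integrable _ M) => //.
  by apply: measurableT_comp => //; exact: measurable_funD.
have i2 (c : R) : lambda.-integrable `[0, 1] (EFin \o (fun x : R => psi (c - x))).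
  apply: (@bounded_itv_integrable _ M) => //.
  by apply: measurableT_comp => //; exact: measurable_funB.
have iD (f g : R -> R) : lambda.-integrable `[0, 1] (EFin \o f) ->
    lambda.-integrable `[0, 1] (EFin \o g) ->
    lambda.-integrable `[0, 1] (EFin \o (fun x => f x + g x)).
  move=> If Ig; rewrite (_ : EFin \o _ = (EFin \o f) \+ (EFin \o g))%E//.
  by apply: integrableD => //; exact: measurable_itv.
rewrite /fold_kernel.
have i12 c := iD _ _ (i1 c) (i2 c).
have m01 : measurable (`[0, 1]%classic : set (measurableTypeR R)) by [].
rewrite (RintegralD m01 (i12 _) (iD _ _ (i12 _) (i12 _))).
rewrite (RintegralD m01 (i12 _) (i12 _)).
rewrite !(RintegralD m01 (i1 _) (i2 _)).
rewrite !(Rintegral_shift mpsi psiM) !(Rintegral_reflect mpsi psiM).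
rewrite (_ : - 2 - T y - 1 = - 3 - T y); last lra.
rewrite (_ : - 2 - T y + 1 = - 1 - T y); last lra.
rewrite (_ : - T y - 1 = - 1 - T y); last lra.
rewrite (_ : - T y + 1 = 1 - T y); last lra.
rewrite (_ : 2 - T y - 1 = 1 - T y); last lra.
rewrite (_ : 2 - T y + 1 = 3 - T y); last lra.
rewrite -(@Rintegral_support _ _ (- 3 - T y) (3 - T y)); last first.
  move=> x nx; apply: psi0; rewrite ltNge; apply/negP; rewrite ler_norml => /andP[? ?].
  apply: nx; apply/andP; split; lra.
have cat := Rintegral_itv_cat mpsi psiM.
rewrite -(@cat (- 3 - T y) (- 2 - T y) (3 - T y)); [|lra|lra].
rewrite -(@cat (- 2 - T y) (- 1 - T y) (3 - T y)); [|lra|lra].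
rewrite -(@cat (- 1 - T y) (- T y) (3 - T y)); [|lra|lra].
rewrite -(@cat (- T y) (1 - T y) (3 - T y)); [|lra|lra].
rewrite -(@cat (1 - T y) (2 - T y) (3 - T y)); [|lra|lra].
ring.
Qed.

End folding.

(** * Square-integrable functions *)

#[local] Instance mu01_ae_filter (R : realType) : Filter (nbhs (almost_everywhere (mu01 R))).
Proof. exact: (ae_filter_ringOfSetsType (mu01 R)). Qed.

Section L2_facts.
Variable R : realType.
Implicit Types f g T w : R -> R.
Notation mu := (mu01 R).
Notation L1 f := (mu.-integrable setT (EFin \o f)).

(** The integral of a nonnegative function is a supremum over the simple functions below it, hence
    monotone. This serves for the iterates of [L0], whose measurability outside [[0, 1]] is not
    established. *)
Lemma le_integral_nonmeasurable (f g : R -> \bar R) :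
  (forall x, 0 <= f x)%E -> (forall x, f x <= g x)%E ->
  (\int[mu]_x f x <= \int[mu]_x g x)%E.
Proof.
move=> f0 fg; rewrite !ge0_integralTE//; last by move=> x; exact: le_trans (fg x).
apply: le_ereal_sup => _ [h hf <-]; exists h => // x; exact: le_trans (hf x) (fg x).
Qed.

Let L1Z (c : R) f : L1 f -> L1 (fun x => c * f x).
Proof. by move=> If; exact: (integrableZl measurableT c If). Qed.

Let L1D f g : L1 f -> L1 g -> L1 (fun x => f x + g x).
Proof. by move=> If Ig; apply: (integrableD measurableT If Ig). Qed.

Let L1B f g : L1 f -> L1 g -> L1 (fun x => f x - g x).
Proof. by move=> If Ig; apply: (integrableB measurableT If Ig). Qed.

Lemma L2_measurable f : L2 f -> measurable_fun setT f.
Proof. by rewrite /L2/= inE => /andP[/[!inE]]. Qed.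

Lemma L2_mul f g : L2 f -> L2 g -> L1 (fun x => f x * g x).
Proof. by move=> Lf Lg; have /Lfun1_integrable := Lfun2_mul_Lfun1 Lf Lg. Qed.

Lemma norm2E f : L1 (fun x => f x ^+ 2) ->
  norm2 f = (Num.sqrt (\int[mu]_x (f x ^+ 2)))%:E.
Proof.
move=> if2; rewrite /norm2 unlock.
rewrite (_ : (\int[mu]_x `|(EFin \o f) x| `^ 2)%E = (\int[mu]_x (f x ^+ 2))%:E); last first.
  rewrite /Rintegral fineK; last exact: integrable_fin_num.
  apply: eq_integral => x _; rewrite /= powR_mulrn//.
  by rewrite real_normK ?num_real.
rewrite poweR_EFin powR12_sqrt//.
by apply: Rintegral_ge0 => x _; exact: sqr_ge0.
Qed.

Lemma L2_intro f : measurable_fun setT f -> L1 (fun x => f x ^+ 2) -> L2 f.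
Proof.
move=> mf if2; rewrite /L2/= inE; apply/andP; split; rewrite inE//=.
by rewrite /finite_norm -/(norm2 f) norm2E// ltry.
Qed.

Lemma L2_sqr f : L2 f -> L1 (fun x => f x ^+ 2).
Proof. exact: Lfun2_integrable_sqr. Qed.

Lemma L2_cst (c : R) : L2 (cst c).
Proof.
apply: L2_intro => //.
exact: (@finite_measure_integrable_cst _ _ _ (prob01 R) setT (c ^+ 2)).
Qed.

Lemma L2_integrable f : L2 f -> L1 f.
Proof. by move=> Lf; have := L2_mul Lf (L2_cst 1); under eq_fun do rewrite /= mulr1. Qed.

Lemma L2_dominated (M : R) f g : measurable_fun setT f -> (forall x, `|f x| <= M * `|g x|) ->
  L2 g -> L2 f.
Proof.
move=> mf fg Lg; apply: L2_intro => //.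
apply: (@le_integrable _ _ _ mu setT measurableT _ (EFin \o (fun x => M ^+ 2 * g x ^+ 2))).
- by apply/measurable_EFinP; exact: measurable_funX.
- move=> x _ /=; rewrite lee_fin [leLHS]ger0_norm ?sqr_ge0//.
  rewrite [leRHS]ger0_norm; last by rewrite mulr_ge0// sqr_ge0.
  have h := fg x.
  rewrite -(real_normK (num_real (f x))) -(real_normK (num_real (g x))) -exprMn.
  by apply: lerXn2r; rewrite // nnegrE// (le_trans _ h).
- exact: (L1Z (M ^+ 2) (L2_sqr Lg)).
Qed.

Lemma L2D f g : L2 f -> L2 g -> L2 (fun x => f x + g x).
Proof.
move=> Lf Lg; apply: L2_intro.
  by apply: measurable_funD; exact: L2_measurable.
rewrite (_ : (fun x => (f x + g x) ^+ 2) =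
    (fun x => f x ^+ 2 + (2 * (f x * g x) + g x ^+ 2))); last first.
  by apply/funext => x; ring.
exact: (L1D (L2_sqr Lf) (L1D (L1Z 2 (L2_mul Lf Lg)) (L2_sqr Lg))).
Qed.

Lemma L2Z (c : R) f : L2 f -> L2 (fun x => c * f x).
Proof.
move=> Lf; apply: (L2_dominated (M := `|c|) _ _ Lf).
  by apply: measurable_funM; [exact: measurable_cst|exact: L2_measurable].
by move=> x; rewrite normrM.
Qed.

Lemma L2B f g : L2 f -> L2 g -> L2 (fun x => f x - g x).
Proof.
move=> Lf Lg; have := L2D Lf (L2Z (-1) Lg).
by under eq_fun do rewrite mulN1r.
Qed.

(** The variance of [|f|] is nonnegative: expanding the integral of [(|f| - m)^2], with [m] the mean
    of [|f|], bounds [m^2] by the integral of [f^2]. *)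
Lemma Rintegral_norm_le_norm2 f : L2 f -> ((\int[mu]_x `|f x|)%:E <= norm2 f)%E.
Proof.
move=> Lf; rewrite norm2E; last exact: L2_sqr.
have f1 : L1 (fun x => `|f x|).
  exact: (integrable_normr (mu := prob01 R) (L2_integrable Lf)).
set m := \int[mu]_x `|f x|.
have m0 : 0 <= m by apply: Rintegral_ge0.
have : 0 <= \int[mu]_x (f x ^+ 2 - (2 * m * `|f x| - m ^+ 2)).
  apply: Rintegral_ge0 => x _; rewrite -(real_normK (num_real (f x))).
  have -> : `|f x| ^+ 2 - (2 * m * `|f x| - m ^+ 2) = (`|f x| - m) ^+ 2 by ring.
  exact: sqr_ge0.
have c1 : L1 (cst (m ^+ 2)) by exact: (@finite_measure_integrable_cst _ _ _ (prob01 R)).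
have f2 : L1 (fun x => 2 * m * `|f x|) by exact: (L1Z (2 * m) f1).
rewrite RintegralB//; last 2 first.
- exact: L2_sqr.
- exact: (L1B f2 c1).
rewrite RintegralB// RintegralZl// -/m (Rintegral_cstT (prob01 R)).
move=> h; rewrite lee_fin -[leLHS](ger0_norm m0) -sqrtr_sqr ler_wsqrtr//.
move: h; rewrite -mulrA -expr2; lra.
Qed.

Lemma ae_eq_Rintegral f g : measurable_fun setT f -> measurable_fun setT g ->
  f = g %[ae mu] -> \int[mu]_x f x = \int[mu]_x g x.
Proof.
move=> mf mg fg; rewrite /Rintegral; congr fine; apply: ae_eq_integral => //.
- exact/measurable_EFinP.
- exact/measurable_EFinP.
- by apply: filterS fg => x /= H _; rewrite H.
Qed.

Lemma Rintegral_norm_eq0 f : L1 f -> \int[mu]_x `|f x| = 0 -> f = cst 0 %[ae mu].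
Proof.
move=> If f0; have mf := measurable_int _ If.
have : ae_eq mu setT (EFin \o f) (cst 0%E).
  apply/ae_eq_integral_abs => //.
  rewrite -[LHS]fineK; last first.
    by apply: integrable_fin_num => //; exact: integrable_abse.
  by congr EFin.
by apply: filterS => x /(_ Logic.I) [].
Qed.

(* The maximizer is [w 1_F] normalized: expanding the square of [T - w 1_F / N]
   settles optimality and uniqueness at once. *)
Lemma linear_functional_max (F : set R) w (J : (R -> R) -> R) :
  measurable F -> L2 w -> (forall T, L2 T -> J T = \int[mu]_x (w x * T x)) ->
  let P := [set T | L2 T /\ {ae mu, forall x, ~ F x -> T x = 0}] `&` @B1 R in
  ~ (forall T, P T -> J T = 0) ->
  exists T, maximizes P J T /\ forall T', maximizes P J T' -> T' = T %[ae mu].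
Proof.
move=> mF Lw JE P Jn0.
pose v := w \_ F.
have mv : measurable_fun setT v.
  by apply/(measurable_restrictT _ _).1 => //; exact: measurable_funTS (L2_measurable Lw).
have Lv : L2 v.
  apply: (L2_dominated (M := 1)) Lw => // x; rewrite mul1r /v patchE.
  by case: ifP => // _; rewrite normr0.
have v0 x : ~ F x -> v x = 0.
  by move=> nF; rewrite /v patchE memNset.
have JvE T : P T -> J T = \int[mu]_x (v x * T x).
  move=> [[LT T0] _]; rewrite JE//; apply: ae_eq_Rintegral.
  - by apply: measurable_funM; exact: L2_measurable.
  - by apply: measurable_funM; exact: L2_measurable.
  apply: filterS T0 => x /= T0.
  have [Fx|nFx] := pselect (F x); first by rewrite /v patchE mem_set.
  by rewrite T0// !mulr0.
set s := \int[mu]_x (v x ^+ 2).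
have s0 : 0 <= s by apply: Rintegral_ge0 => x _; exact: sqr_ge0.
(* If [v] has norm zero, it vanishes almost everywhere and [J] is zero on [P], which is excluded. *)
have [s_eq0|s_neq0] := eqVneq s 0.
  exfalso; apply: Jn0 => T PT; rewrite JvE//.
  have /Rintegral_norm_eq0 v_ae0 : \int[mu]_x `|v x| = 0.
    apply/eqP; rewrite eq_le Rintegral_ge0// andbT -lee_fin.
    have := Rintegral_norm_le_norm2 Lv.
    by rewrite norm2E ?sqrtr0 -?/s ?s_eq0 ?sqrtr0//; exact: L2_sqr.
  rewrite -[RHS](Rintegral_cstT (prob01 R) 0); apply: ae_eq_Rintegral => //.
    by apply: measurable_funM => //; exact: L2_measurable PT.1.1.
  by apply: filterS (v_ae0 (L2_integrable Lv)) => x /= vx _; rewrite vx// mul0r.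
have {s_neq0}s_gt0 : 0 < s by rewrite lt_neqAle eq_sym s_neq0.
pose N := Num.sqrt s.
have N_gt0 : 0 < N by rewrite sqrtr_gt0.
have NN : N ^+ 2 = s by rewrite sqr_sqrtr.
pose U x := N^-1 * v x.
have LU : L2 U by exact: L2Z.
have UU : \int[mu]_x (U x ^+ 2) = 1.
  under eq_Rintegral do rewrite exprMn.
  rewrite RintegralZl//; last exact: L2_sqr.
  by rewrite -/s -NN exprVn mulVf// sqrf_eq0 gt_eqF.
have PU : P U.
  split; [split=> //|split=> //].
    by apply: aeW => x nF; rewrite /U v0// mulr0.
  by rewrite norm2E ?UU ?sqrtr1//; exact: L2_sqr.
have JU T : P T -> J T = N * \int[mu]_x (U x * T x).
  move=> PT; rewrite JvE// -RintegralZl//; last exact: L2_mul PT.1.1.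
  by apply: eq_Rintegral => x _; rewrite /U !mulrA mulfV ?mul1r// gt_eqF.
have JUU : J U = N.
  by rewrite JU//; under eq_Rintegral do rewrite -expr2; rewrite UU mulr1.
(* The square expands to [||T||^2 - 2 <U, T> + ||U||^2], where [||T|| <= 1], [||U|| = 1] and
   [<U, T> = J T / N]. *)
have expand T : P T ->
    \int[mu]_x ((T x - U x) ^+ 2) <= 2 - 2 * (J T / N).
  move=> PT; have LT := PT.1.1.
  have T1 : \int[mu]_x (T x ^+ 2) <= 1.
    have := PT.2.2; rewrite norm2E; last exact: L2_sqr.
    rewrite lee_fin -[leRHS]sqrtr1 ler_sqrt//.
  rewrite (@eq_Rintegral _ _ _ mu setT
    (fun x => T x ^+ 2 - (2 * (U x * T x) - U x ^+ 2))); last first.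
    by move=> x _; ring.
  have iUT : L1 (fun x => 2 * (U x * T x)).
    exact: (L1Z 2 (L2_mul LU LT)).
  rewrite RintegralB//; last 2 first.
  - exact: L2_sqr.
  - exact: (L1B iUT (L2_sqr LU)).
  rewrite RintegralB//; last exact: L2_sqr.
  rewrite RintegralZl//; last exact: L2_mul.
  rewrite UU JU// mulrAC mulfV ?gt_eqF// mul1r; lra.
have sq_ge0 T : 0 <= \int[mu]_x ((T x - U x) ^+ 2).
  by apply: Rintegral_ge0 => x _; exact: sqr_ge0.
have JN T : P T -> J T <= N.
  move=> PT; have := le_trans (sq_ge0 T) (expand T PT).
  by rewrite subr_ge0 ger_pMr// ler_pdivrMr// mul1r.
exists U; split; first by split=> // T PT; rewrite JUU; exact: JN.
move=> T [PT maxT].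
have JT : J T = N by apply/eqP; rewrite eq_le JN//= -JUU maxT.
have := expand T PT; rewrite JT mulfV ?gt_eqF// mulr1 subrr => TU0.
have LTU : L2 (fun x => T x - U x) by exact: L2B PT.1.1 LU.
have : (fun x => T x - U x) = cst 0 %[ae mu].
  apply: Rintegral_norm_eq0; first exact: L2_integrable.
  apply/eqP; rewrite eq_le Rintegral_ge0// andbT -lee_fin.
  apply: le_trans (Rintegral_norm_le_norm2 LTU) _.
  rewrite norm2E; last exact: L2_sqr.
  by rewrite lee_fin ler0_sqrtr.
by apply: filterS => x /= TU _; apply/eqP; rewrite -subr_eq0 TU.
Qed.

End L2_facts.

(** * Representation of the objective *)

Section linear_response.
Variables (R : realType) (T0 rho : R -> R) (K : R).
Hypothesis T0_meas : measurable_fun `[0 : R, 1] T0.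
Hypothesis T0_itv : forall x : R, x \in `[0, 1] -> T0 x \in `[0, 1].
Hypothesis K_gt0 : 0 < K.
Hypothesis rhoK : forall x y, `|rho x - rho y| <= K * `|x - y|.
Hypothesis rho_dens : probability_density rho.
Hypothesis rho_out : forall x, 1 < `|x| -> rho x = 0.
Hypothesis L0_A1 : A1 (L0 rho T0).
Notation lambda := (@lebesgue_measure R).
Notation mu := (mu01 R).
Notation L1 f := (mu.-integrable setT (EFin \o f)).

(* [T0] is only measurable on [[0, 1]]; extending it by [0] does not change any
   of the integrals over [[0, 1]]. *)
Let T1 := T0 \_ `[0, 1].

Let T1E y : y \in `[0, 1] -> T1 y = T0 y.
Proof. by move=> y01; rewrite /T1 patchE mem_set. Qed.

(** The extension value [0] lies in [[0, 1]], so the mass identities for the kernels hold at every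
    real [y]. *)
Let T1_itv y : T1 y \in `[0, 1].
Proof.
rewrite /T1 patchE; case: ifPn => [|_]; first by rewrite inE /=; exact: T0_itv.
by rewrite in_itv/= lexx ler01.
Qed.

Let mT1 : measurable_fun setT T1.
Proof. by apply/(measurable_restrictT _ _).1. Qed.

Let mrho : measurable_fun setT rho. Proof. by case: rho_dens. Qed.

(** [rho] vanishes at [2], a point at distance at most [3] from any point of [[-1, 1]]. *)
Let rho_le x : `|rho x| <= 3 * K.
Proof.
have [x1|x1] := leP `|x| 1; last first.
  by rewrite rho_out// normr0 mulr_ge0// ltW.
have r2 : rho 2 = 0 by rewrite rho_out// gtr0_norm ?ltr1n.
have := rhoK x 2; rewrite r2 subr0 => /le_trans; apply.
rewrite [leLHS]mulrC ler_wpM2r ?(ltW K_gt0)// (le_trans (ler_normB _ _))//.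
by rewrite [`|2|]ger0_norm// -[3]/(1 + 2)%:R natrD lerD.
Qed.

Let drho := rho^`()%classic.

Let mdrho : measurable_fun setT drho.
Proof. exact: measurable_derive1 (lipschitz_continuous K_gt0 rhoK). Qed.

Let drho_le x : `|drho x| <= Num.max K `|point : R|.
Proof. exact: derive1_lipschitz_le. Qed.

Let drho_out x : 1 < `|x| -> drho x = 0.
Proof.
move=> x1; rewrite /drho derive1E (@near_eq_derive _ _ _ rho (cst 0)) ?oner_eq0//.
  exact: derive_cst.
have : `|y| @[y --> x] --> `|x| by apply: cvg_norm; exact: cvg_id.
by move=> /cvgr_gt/(_ _ x1); apply: filterS => y; exact: rho_out.
Qed.

Let k := fold_kernel rho T1.
Let q := fold_kernel drho T1.
Notation op := (kernel_op (prob01 R)).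

Let bk : bounded_kernel (X := measurableTypeR R) (6 * (3 * K)) k.
Proof. exact: bounded_kernel_fold. Qed.

Let bq : bounded_kernel (X := measurableTypeR R) (6 * Num.max K `|point : R|) q.
Proof. exact: bounded_kernel_fold. Qed.

Let k_ge0 x y : 0 <= k x y.
Proof. by rewrite /k /fold_kernel !addr_ge0//; case: rho_dens. Qed.

Let k_mass y : \int[prob01 R]_x k x y = 1.
Proof.
rewrite [LHS](Rintegral_fold mrho rho_le rho_out mT1 (T1_itv y)).
by case: rho_dens => _ _ int1; rewrite /Rintegral int1.
Qed.

(** Unfolding leaves the integral of [drho] over []-2, 2]], that is [rho 2 - rho (-2)], and [rho]
    vanishes at both ends. *)
Let q_mass y : \int[prob01 R]_x q x y = 0.
Proof.
rewrite [LHS](Rintegral_fold mdrho drho_le drho_out mT1 (T1_itv y)).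
rewrite -(@Rintegral_support _ _ (-2) 2); last first.
  move=> x nx; apply: drho_out; rewrite ltNge; apply/negP; rewrite ler_norml => /andP[? ?].
  apply: nx; apply/andP; split; lra.
rewrite (Rintegral_derive1_lipschitz K_gt0 rhoK); last lra.
by rewrite !rho_out ?subrr// ?normrN gtr0_norm// ltr1n.
Qed.

(** [L0] reads its argument on [[0, 1]] only. Allowing two functions lets a measurable [g] stand in
    for an iterate of [L0]. *)
Let L0E (f g : R -> R) x : (forall y, y \in `[0, 1] -> f y = g y) ->
  measurable_fun setT g -> x \in `[0, 1] -> L0 rho T0 f x = op k g x.
Proof.
move=> fg mg x01; rewrite /L0 /kernel_op.
rewrite -[RHS]Rintegral_mu01; last first.
  by apply: measurable_funM => //; exact: (bounded_kernel_row x bk).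
apply: eq_Rintegral => y; rewrite inE /= => y01; rewrite fg//; congr (_ * _).
rewrite /k0 -(T1E y01).
exact: P_pi_fold.
Qed.

Let op_k_L2 g : L1 g -> L2 (op k g).
Proof.
move=> ig; have mkg := measurable_kernel_op (mu := prob01 R) bk ig.
apply: (L2_dominated (M := 1) mkg _ (L2_cst _)) => x.
rewrite mul1r; apply: le_trans (kernel_op_le (mu := prob01 R) x bk ig) _; exact: ler_norm.
Qed.

Let iter_L2 n g : L2 g -> L2 (iter n (op k) g).
Proof. by move=> Lg; elim: n => [//|n IH] /=; exact: op_k_L2 (L2_integrable IH). Qed.

Let iter_L0E n g x : L2 g -> x \in `[0, 1] ->
  iter n (L0 rho T0) g x = iter n (op k) g x.
Proof.
move=> Lg; elim: n x => [//|n IH] x x01 /=.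
by apply: L0E => //; exact: L2_measurable (iter_L2 n Lg).
Qed.

Let norm2_le (f g : R -> R) : (forall x, `|f x| <= `|g x|) -> (norm2 f <= norm2 g)%E.
Proof.
move=> fg; rewrite /norm2 unlock.
have ge0 (h : R -> R) : (0 <= \int[mu]_x `|(EFin \o h) x| `^ 2)%E.
  by apply: integral_ge0 => x _; exact: poweR_ge0.
apply: gt0_ler_poweR; rewrite ?invr_ge0// ?in_itv/= ?leey ?andbT; do ?exact: ge0.
apply: le_integral_nonmeasurable => x; first by rewrite lee_fin powR_ge0.
by rewrite lee_fin ge0_ler_powR ?nnegrE.
Qed.

(** On a probability space the [L1] norm is at most the 2-norm, which A1 sends to zero. *)
Let decay g : V g -> \int[prob01 R]_x `|iter n (op k) g x| @[n --> \oo] --> (0 : R).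
Proof.
move=> Vg; have Lg := Vg.1.
pose a n := \int[prob01 R]_x `|iter n (op k) g x|.
have a_ge0 n : 0 <= a n by exact: Rintegral_ge0.
have a_le n : ((a n)%:E <= norm2 (iter n (L0 rho T0) g))%E.
  (* The iterates of [op k] and [L0] are known to agree on [[0, 1]] only; after truncation the first
     is dominated by the second at every point. *)
  pose r := iter n (op k) g \_ `[0, 1].
  have mr : measurable_fun setT r.
    apply/(measurable_restrictT _ _).1 => //; apply: measurable_funTS.
    exact: L2_measurable (iter_L2 n Lg).
  have Lr : L2 r.
    apply: (L2_dominated (M := 1) mr _ (iter_L2 n Lg)) => x; rewrite mul1r /r patchE.
    by case: ifP => // _; rewrite normr0.
  have -> : a n = \int[mu]_x `|r x|.
    apply: (@ae_eq_Rintegral R).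
    - by apply: measurableT_comp => //; exact: L2_measurable (iter_L2 n Lg).
    - exact: measurableT_comp.
    by apply: ae_mu01 => x x01 _; rewrite /r patchE mem_set.
  apply: le_trans (Rintegral_norm_le_norm2 Lr) _; apply: norm2_le => x.
  rewrite /r patchE; case: ifPn => [|_]; last by rewrite normr0.
  by rewrite inE/= => x01; rewrite iter_L0E.
have : (a n)%:E @[n --> \oo] --> 0%E.
  apply: (squeeze_cvge _ (cvg_cst 0%E) (L0_A1 Vg)).
  by apply: nearW => n; rewrite lee_fin a_ge0 a_le.
by move/fine_cvg.
Qed.

Let bounded_V (C : R) (g : R -> R) : measurable_fun setT g -> (forall x, `|g x| <= C) ->
  \int[mu]_x g x = 0 -> V g.
Proof.
move=> mg gC g0; split=> //; apply: (L2_dominated (M := 1) mg _ (L2_cst C)) => x.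
by rewrite mul1r /= (le_trans (gC x))// ler_norm.
Qed.

Let op_k_ae (f g : R -> R) x : measurable_fun setT f -> measurable_fun setT g ->
  f = g %[ae mu] -> op k f x = op k g x.
Proof.
move=> mf mg fg; have mk := bounded_kernel_row x bk.
apply: (@ae_eq_Rintegral R); [exact: measurable_funM..|].
by apply: filterS fg => y /= H _; rewrite H.
Qed.

(** The iterates of [h] all have the [L1] norm of [h], and these norms tend to zero. This makes the
    resolvent unique up to null sets. *)
Let fixed_eq0 h : V h -> op k h = h %[ae mu] -> h = cst 0 %[ae mu].
Proof.
move=> Vh hk; have Lh := Vh.1; have mh := L2_measurable Lh.
have iterE n : iter n (op k) h = h %[ae mu].
  elim: n => [|n IH]; first exact: ae_eq_refl.
  rewrite iterS (_ : op k (iter n (op k) h) = op k h)//.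
  by apply/funext => x; apply: op_k_ae => //; exact: L2_measurable (iter_L2 n Lh).
apply: Rintegral_norm_eq0; first exact: L2_integrable.
have := decay Vh.
have cE n : \int[prob01 R]_x `|iter n (op k) h x| = \int[mu]_x `|h x|.
  apply: (@ae_eq_Rintegral R).
  - by apply: measurableT_comp => //; exact: L2_measurable (iter_L2 n Lh).
  - exact: measurableT_comp.
  by apply: filterS (iterE n) => x /= H _; rewrite H.
under eq_fun do rewrite cE.
move=> c0; have := cvg_lim (@Rhausdorff _) c0.
by rewrite lim_cst; [apply|exact: Rhausdorff].
Qed.

(** The response is minus the kernel [H] applied to [T * f0]; moving [H] onto [c] gives
    [w = - (f0 * u)], which is in [L2] because [u] is bounded. *)
Lemma linear_response_representation (f0 c : R -> R) : L2 f0 -> L2 c ->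
  exists w, L2 w /\
    forall T, L2 T -> inner c (Rhat rho T0 f0 T) = \int[mu]_x (w x * T x).
Proof.
move=> Lf0 Lc.
have [N [H [bH H0 HL]]] := resolvent_kernel (mu := prob01 R) bk k_ge0 k_mass
  (fun C g mg gC g0 => decay (bounded_V mg gC g0)) bq q_mass.
pose u := op (fun y x => H x y) c.
have ic : L1 c by exact: L2_integrable.
have meas_u : measurable_fun setT u.
  exact: (measurable_kernel_op (mu := prob01 R) (bounded_kernelT bH) ic).
exists (fun y => - (f0 y * u y)); split.
  have iu y := kernel_op_le (mu := prob01 R) y (bounded_kernelT bH) ic.
  apply: (L2_dominated _ _ Lf0).
    by apply: measurableT_comp => //; apply: measurable_funM => //; exact: L2_measurable.
  by move=> y; rewrite normrN normrM mulrC ler_wpM2r//; exact: iu.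
move=> T LT.
have iv : L1 (fun y => T y * f0 y) by exact: L2_mul.
pose h := op H (fun y => T y * f0 y).
have mh : measurable_fun setT h by exact: (measurable_kernel_op (mu := prob01 R) bH iv).
have Vh : V h.
  apply: (bounded_V mh (fun x => kernel_op_le (mu := prob01 R) x bH iv)).
  have i1 : L1 (cst (1 : R)) by exact: L2_integrable (L2_cst _).
  have := kernel_op_adjoint (mu := prob01 R) bH i1 iv.
  under eq_Rintegral do rewrite mul1r.
  move=> ->; rewrite -[RHS](Rintegral_cstT (prob01 R) 0).
  apply: eq_Rintegral => y _; rewrite /kernel_op.
  by under eq_Rintegral do rewrite mulr1; rewrite H0 mulr0.
have mv : measurable_fun setT (fun y => T y * f0 y).
  by apply: measurable_funM; exact: L2_measurable.
set g := fun z => \int[lambda]_(y in `[0, 1]) (P_pi (tau (- T0 y) drho) z * T y * f0 y).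
have hE x : x \in `[0, 1] -> h x - op k h x = g x.
  move=> x01; rewrite (kernel_opA (mu := prob01 R) x bk bH iv) /g.
  transitivity (op q (fun y => T y * f0 y) x).
    have ikH := bounded_kernel_comp (prob01 R) bk bH.
    rewrite /h {1 2}/kernel_op -RintegralB//; last 2 first.
    - exact: (kernel_op_integrand (mu := prob01 R) x bH iv).
    - exact: (kernel_op_integrand (mu := prob01 R) x ikH iv).
    by apply: eq_Rintegral => y _; rewrite -mulrBl HL.
  rewrite /kernel_op -[LHS]Rintegral_mu01; last first.
    by apply: measurable_funM => //; exact: (bounded_kernel_row x bq).
  apply: eq_Rintegral => y; rewrite inE /= => y01; rewrite mulrA; congr (_ * _ * _).
  by rewrite -(T1E y01); apply/esym; exact: P_pi_fold.
have hres : (fun x => h x - L0 rho T0 h x) = g %[ae mu].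
  by apply: ae_mu01 => x x01 _; rewrite (@L0E h h)// hE.
pose r := resolvent (L0 rho T0) g.
(* [h] shows that the set searched by [xget] is inhabited, so [r] is a genuine solution and not the
   default [0]. *)
have [Vr rE] : V r /\ (fun x => r x - L0 rho T0 r x) = g %[ae mu].
  by rewrite /r /resolvent; apply: (@xgetPex _ (fun=> 0)
    [set h | V h /\ (fun x => h x - L0 rho T0 h x) = g %[ae mu]]); exists h.
have mr := L2_measurable Vr.1.
have rh : r = h %[ae mu].
  have Vd : V (fun x => r x - h x).
    split; first exact: L2B Vr.1 Vh.1.
    rewrite RintegralB//; [by rewrite Vr.2 Vh.2 subrr|exact: L2_integrable Vr.1|
      exact: L2_integrable Vh.1].
  (* [r] and [h] solve the same equation, so their difference is a fixed point of zero mean. *)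
  have : op k (fun x => r x - h x) = (fun x => r x - h x) %[ae mu].
    have := ae_mu01 (fun x x01 => @L0E r r x (fun _ _ => erefl) mr x01).
    have := ae_mu01 (fun x x01 => hE x x01).
    apply: filterS3 rE => x rx hx Lx _.
    have -> : op k (fun x => r x - h x) x = op k r x - op k h x.
      rewrite /kernel_op; under eq_Rintegral do rewrite mulrBr.
      rewrite RintegralB//.
      - exact: (kernel_op_integrand (mu := prob01 R) x bk (L2_integrable Vr.1)).
      - exact: (kernel_op_integrand (mu := prob01 R) x bk (L2_integrable Vh.1)).
    have := rx I; rewrite Lx -hx; lra.
  move=> /(fixed_eq0 Vd); apply: filterS => x /= d0 _.
  by apply/eqP; rewrite -subr_eq0 d0.
transitivity (\int[mu]_x (- (c x * h x))).
  rewrite /inner; apply: (@ae_eq_Rintegral R).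
  - apply: measurable_funM; first exact: L2_measurable.
    by apply: measurableT_comp => //; exact: mr.
  - by apply: measurableT_comp => //; apply: measurable_funM => //; exact: L2_measurable.
  by apply: filterS rh => x /= rx _; rewrite /Rhat -/g -/r rx// mulrN.
have intN (f : R -> R) : L1 f -> \int[mu]_x (- f x) = - \int[mu]_x f x.
  move=> If; under eq_Rintegral do rewrite -mulN1r.
  by rewrite RintegralZl// mulN1r.
rewrite intN; last exact: L2_mul Lc Vh.1.
rewrite [X in - X](kernel_op_adjoint (mu := prob01 R) bH ic iv) -intN; last first.
  have := integrable_mul_le_cst (mu := prob01 R) meas_u
    (fun y => kernel_op_le (mu := prob01 R) y (bounded_kernelT bH) ic) iv.
  by under eq_fun do rewrite /= mulrC.
by apply: eq_Rintegral => y _; rewrite -/(u y); ring.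
Qed.

End linear_response.

(** * Lipschitz constants, the constraint set and the conclusion *)

Lemma lipschitzP (R : realType) (f : R -> R) : [lipschitz f x | x in setT] ->
  exists2 K, 0 < K & forall x y, `|f x - f y| <= K * `|x - y|.
Proof.
(* The estimate is available for constants strictly above [M], and [M] may be negative. *)
move=> [M [_ MP]]; exists (Num.max M 0 + 1).
  by rewrite ltr_wpDl// le_max lexx orbT.
have h : M < Num.max M 0 + 1
  by rewrite (le_lt_trans (_ : M <= Num.max M 0)) ?le_max ?lexx ?ltrDl.
by move=> x y; exact: (MP _ h (x, y)).
Qed.

Lemma measurable_Ftilde (R : realType) (T0 : R -> R) (l : R) :
  measurable_fun `[0 : R, 1] T0 -> measurable (Ftilde T0 l).
Proof.
move=> mT0; have := mT0 (measurable_itv _) `[l, 1 - l]%classic (measurable_itv _).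
rewrite (_ : _ `&` _ = Ftilde T0 l)//.
Qed.

Theorem proposition7p3 (R : realType) (T0 rho f0 c : R -> R) (l : R)
    (T0_meas : measurable_fun `[0 : R, 1] T0)
    (T0_itv : forall x : R, x \in `[0, 1] -> T0 x \in `[0, 1])
    (rho_lip : [lipschitz rho x | x in setT])
    (rho_dens : probability_density rho)
    (rho_supp : closure [set x | rho x != 0] `<=` `[-1, 1])
    (L0_A1 : A1 (L0 rho T0))
    (f0P : normalized_fixed_point (L0 rho T0) f0)
    (cP : orthogonal_compl (span1 f0) c)
    (l_ge0 : 0 <= l) :
  let P_l := S_supp T0 l `&` @B1 R in
  let J := fun T : R -> R => inner c (Rhat rho T0 f0 T) in
  ~ (forall T, P_l T -> J T = 0) ->
  exists T : R -> R, maximizes P_l J T /\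
    forall T', maximizes P_l J T' -> T' = T %[ae @mu01 R].
Proof.
move=> P_l J; have [K K_gt0 rhoK] := lipschitzP rho_lip.
have rho_out x : 1 < `|x| -> rho x = 0.
  move=> x1; apply: contrapT => /eqP rx0.
  have : closure [set x | rho x != 0] x by exact: subset_closure.
  move=> /rho_supp.
  by rewrite /= in_itv/= -ler_norml leNgt x1.
have [Lf0 _ _] := f0P; have [Lc _] := cP.
have [w [Lw JE]] := linear_response_representation T0_meas T0_itv K_gt0 rhoK
  rho_dens rho_out L0_A1 Lf0 Lc.
exact: linear_functional_max (measurable_Ftilde l T0_meas) Lw JE.
Qed.
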